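(* Let $k$ be a field, $H$ a quasi-Hopf algebra over $k$, $B$ a Hopf algebra in ${}_H^H\mathcal{YD}$ with antipode $\underline S$, and $M\in\mathcal M_B^B$ a right $B$-Hopf module, with $B$-action $m\otimes b\mapsto m\leftarrow b$ and $B$-coaction $\underline\rho_M(m)=\sum m_{(\underline 0)}\otimes m_{(\underline 1)}$. (i) $M^{{\rm co}B}=\{m\in M\mid \underline\rho_M(m)=m\otimes 1_B\}\in{}_H^H\mathcal{YD}$ (with the $H$-action and $H$-coaction of $M$). (ii) For all $m\in M$, $P(m)=\sum m_{(\underline 0)}\leftarrow\underline S(m_{(\underline 1)})\in M^{{\rm co}B}$. (iii) For all $n\in M^{{\rm co}B}$ and $b\in B$: $\underline\rho_M(n\leftarrow b)=\sum (x^1\cdot n)\leftarrow(x^2\cdot b_{\underline 1})\otimes x^3\cdot b_{\underline 2}$ and $P(n\leftarrow b)=\underline\varepsilon(b)n$. (iv) The map $F:\ M^{{\rm co}B}\otimes B\to M$, $F(n\otimes b)=n\leftarrow b$, is an isomorphism of Hopf modules in ${}_H^H\mathcal{YD}$, with inverse $G$ given by $G(m)=\sum P(m_{(\underline 0)})\otimes m_{(\underline 1)}$.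
   Context: All tensor products are over the field $k$. A quasi-bialgebra is $(H,\Delta,\varepsilon,\Phi)$ where $H$ is an associative unital $k$-algebra, $\Phi\in H\otimes H\otimes H$ is invertible, and $\Delta:H\to H\otimes H$, $\varepsilon:H\to k$ are algebra maps such that, for all $h\in H$: $(id\otimes\Delta)(\Delta(h))=\Phi\,(\Delta\otimes id)(\Delta(h))\,\Phi^{-1}$; $(id\otimes\varepsilon)(\Delta(h))=h=(\varepsilon\otimes id)(\Delta(h))$; $(1\otimes\Phi)(id\otimes\Delta\otimes id)(\Phi)(\Phi\otimes 1)=(id\otimes id\otimes\Delta)(\Phi)(\Delta\otimes id\otimes id)(\Phi)$; $(id\otimes\varepsilon\otimes id)(\Phi)=1\otimes 1\otimes 1$. Notation: $\Delta(h)=\sum h_1\otimes h_2$; $\Phi=\sum X^1\otimes X^2\otimes X^3=\sum Y^1\otimes Y^2\otimes Y^3$, $\Phi^{-1}=\sum x^1\otimes x^2\otimes x^3=\sum y^1\otimes y^2\otimes y^3$ (different letters denote independent copies); $\Delta(X^i)=\sum X^i_1\otimes X^i_2$, etc. A quasi-Hopf algebra is a quasi-bialgebra with an anti-automorphism $S$ of the algebra $H$ and $\alpha,\beta\in H$ such that for all $h$: $\sum S(h_1)\alpha h_2=\varepsilon(h)\alpha$, $\sum h_1\beta S(h_2)=\varepsilon(h)\beta$, $\sum X^1\beta S(X^2)\alpha X^3=1$, $\sum S(x^1)\alpha x^2\beta S(x^3)=1$. By rescaling, one assumes $\varepsilon(\alpha)=\varepsilon(\beta)=1$ and $\varepsilon\circ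 S=\varepsilon$. The category ${}_H^H\mathcal{YD}$: objects (left Yetter-Drinfeld modules) are left $H$-modules $M$ with a linear map $\lambda_M:M\to H\otimes M$, $\lambda_M(m)=\sum m_{(-1)}\otimes m_{(0)}$, such that for all $m\in M$, $h\in H$ $$\sum X^1m_{(-1)}\otimes (X^2\cdot m_{(0)})_{(-1)}X^3\otimes (X^2\cdot m_{(0)})_{(0)}=\sum X^1(Y^1\cdot m)_{(-1)_1}Y^2\otimes X^2(Y^1\cdot m)_{(-1)_2}Y^3\otimes X^3\cdot (Y^1\cdot m)_{(0)},$$ $\sum\varepsilon(m_{(-1)})m_{(0)}=m$, and $\sum h_1m_{(-1)}\otimes h_2\cdot m_{(0)}=\sum (h_1\cdot m)_{(-1)}h_2\otimes (h_1\cdot m)_{(0)}$. Morphisms are the $k$-linear maps preserving $H$-action and $H$-coaction. It is a monoidal category: $M\otimes N$ has action $h\cdot(m\otimes n)=\sum h_1\cdot m\otimes h_2\cdot n$ and coaction $$\lambda_{M\otimes N}(m\otimes n)=\sum X^1(x^1Y^1\cdot m)_{(-1)}x^2(Y^2\cdot n)_{(-1)}Y^3\otimes X^2\cdot(x^1Y^1\cdot m)_{(0)}\otimes X^3x^3\cdot(Y^2\cdot n)_{(0)};$$ the unit object is $k$ (action via $\varepsilon$, coaction $1\mapsto 1_H\otimes 1$); the associativity constraint is $(U\otimes V)\otimes W\to U\otimes(V\otimes W)$, $(u\otimes v)\otimes w\mapsto\Phi\cdot(u\otimes(v\otimes w))$; the braiding is $c_{M,N}(m\otimes n)=\sum m_{(-1)}\cdot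 n\otimes m_{(0)}$. An algebra $B$ in ${}_H^H\mathcal{YD}$: an object with a multiplication $B\otimes B\to B$ and a unit map $k\to B$, $1\mapsto 1_B$, both morphisms in ${}_H^H\mathcal{YD}$, with $(ab)c=\sum(X^1\cdot a)[(X^2\cdot b)(X^3\cdot c)]$ and $1_Bb=b1_B=b$. A coalgebra $B$: an object with morphisms $\underline\Delta:B\to B\otimes B$, $\underline\Delta(b)=\sum b_{\underline 1}\otimes b_{\underline 2}$, and $\underline\varepsilon:B\to k$ in ${}_H^H\mathcal{YD}$, with $\Phi\cdot(\underline\Delta\otimes id)(\underline\Delta(b))=(id\otimes\underline\Delta)(\underline\Delta(b))$ and the usual counit property. A bialgebra $B$ is an algebra and a coalgebra such that $\underline\Delta$ and $\underline\varepsilon$ are algebra morphisms; in particular $\underline\Delta(1_B)=1_B\otimes 1_B$ and $$\underline\Delta(bb')=\sum [y^1X^1\cdot b_{\underline 1}][y^2Y^1(x^1X^2\cdot b_{\underline 2})_{(-1)}x^2X^3_1\cdot b'_{\underline 1}]\otimes[y^3_1Y^2\cdot(x^1X^2\cdot b_{\underline 2})_{(0)}][y^3_2Y^3x^3X^3_2\cdot b'_{\underline 2}].$$ A Hopf algebra in ${}_H^H\mathcal{YD}$ is a bialgebra with a morphism $\underline S:B\to B$ in ${}_H^H\mathcal{YD}$ with $\sum\underline S(b_{\underline 1})b_{\underline 2}=\sum b_{\underline 1}\underline S(b_{\underline 2})=\underline\varepsilon(b)1_B$. A right $B$-Hopf module (object of $\mathcal M_B^B$) is $M\in{}_H^H\mathcal{YD}$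 with morphisms in ${}_H^H\mathcal{YD}$: an action $M\otimes B\to M$, $m\otimes b\mapsto m\leftarrow b$, and a coaction $\underline\rho_M:M\to M\otimes B$, $\underline\rho_M(m)=\sum m_{(\underline 0)}\otimes m_{(\underline 1)}$, such that $m\leftarrow 1_B=m$, $(m\leftarrow b)\leftarrow b'=\sum(X^1\cdot m)\leftarrow[(X^2\cdot b)(X^3\cdot b')]$, $\Phi\cdot(\underline\rho_M\otimes id_B)(\underline\rho_M(m))=(id_M\otimes\underline\Delta)(\underline\rho_M(m))$, $\sum\underline\varepsilon(m_{(\underline 1)})m_{(\underline 0)}=m$, and $$\underline\rho_M(m\leftarrow b)=\sum(y^1X^1\cdot m_{(\underline 0)})\leftarrow[y^2Y^1(x^1X^2\cdot m_{(\underline 1)})_{(-1)}x^2X^3_1\cdot b_{\underline 1}]\otimes[y^3_1Y^2\cdot(x^1X^2\cdot m_{(\underline 1)})_{(0)}][y^3_2Y^3x^3X^3_2\cdot b_{\underline 2}].$$ Morphisms in $\mathcal M_B^B$ are morphisms in ${}_H^H\mathcal{YD}$ preserving the $B$-action and $B$-coaction. For $N\in{}_H^H\mathcal{YD}$, $N\otimes B$ is a right $B$-Hopf module with the tensor product structure in ${}_H^H\mathcal{YD}$, $B$-action $(n\otimes b)\prec b'=\sum X^1\cdot n\otimes[(X^2\cdot b)(X^3\cdot b')]$ and $B$-coaction $\underline\rho_{N\otimes B}(n\otimes b)=\sum x^1\cdot n\otimes x^2\cdot b_{\underline 1}\otimes x^3\cdot b_{\underline 2}$; this is the structure on $M^{{\rm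 co}B}\otimes B$ in (iv). *)

(* Defs.v *)
From HB Require Import structures.
From mathcomp Require Import all_boot all_order all_algebra.
From mathcomp Require Import boolp classical_sets.

Set Warnings "-redundant-canonical-projection,-projection-no-head-constant".
Set Implicit Arguments.
Unset Strict Implicit.
Unset Printing Implicit Defensive.

Import GRing.Theory.
Local Open Scope ring_scope.

Section TensorProduct.
Variables (k : fieldType) (U V : lmodType k).

(* A list [:: (u1, v1); ...; (un, vn)] stands for the formal sum of the pairs
   (ui, vi); scalars of the free module are absorbed into the first component.
   [tens_rel] is the congruence generated by the relations of bilinearity, so
   that [tens] is the usual quotient construction of the tensor product. *)
Inductive tens_rel : seq (U * V) -> seq (U * V) -> Prop :=
| tens_refl s : tens_rel s s
| tens_sym s t : tens_rel s t -> tens_rel t s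
| tens_trans s t r : tens_rel s t -> tens_rel t r -> tens_rel s r
| tens_cat s s' t t' :
    tens_rel s s' -> tens_rel t t' -> tens_rel (s ++ t) (s' ++ t')
| tens_catC s t : tens_rel (s ++ t) (t ++ s)
| tens_zero v : tens_rel [:: (0, v)] [::]
| tens_addl u u' v : tens_rel [:: (u + u', v)] [:: (u, v); (u', v)]
| tens_addr u v v' : tens_rel [:: (u, v + v')] [:: (u, v); (u, v')]
| tens_scale a u v : tens_rel [:: (a *: u, v)] [:: (u, a *: v)].

Definition tens_eq (s t : seq (U * V)) : bool := `[< tens_rel s t >].

Lemma tens_eq_refl : reflexive tens_eq.
Proof. by move=> s; apply/asboolP/tens_refl. Qed.

Lemma tens_eq_sym : symmetric tens_eq.
Proof. by move=> s t; apply: asbool_equiv_eq; split=> /tens_sym. Qed.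

Lemma tens_eq_trans : transitive tens_eq.
Proof.
by move=> t s r /asboolP st /asboolP tr; apply/asboolP; apply: tens_trans tr.
Qed.

Canonical tens_equiv := EquivRel tens_eq tens_eq_refl tens_eq_sym tens_eq_trans.

Definition tens := {eq_quot tens_equiv}%qT.

HB.instance Definition _ := Choice.on tens.

Definition tens_class (s : seq (U * V)) : tens := (\pi_{eq_quot tens_equiv} s)%qT.
Definition tens_repr (t : tens) : seq (U * V) :=
  @repr _ {eq_quot tens_equiv}%qT t.
Definition tensor (u : U) (v : V) : tens := tens_class [:: (u, v)].

Lemma tens_reprK t : tens_class (tens_repr t) = t.
Proof. exact: reprK. Qed.

Lemma tens_classP s t : tens_class s = tens_class t <-> tens_rel s t.
Proof.
by split=> [/eqquotP/asboolP|/asboolP st]; last exact/eqquotP.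
Qed.

Lemma tens_repr_class s : tens_rel (tens_repr (tens_class s)) s.
Proof. by apply/tens_classP; rewrite tens_reprK. Qed.

Definition tens_add (s t : tens) := tens_class (tens_repr s ++ tens_repr t).
Definition tens_scaling (a : k) (t : tens) :=
  tens_class [seq (a *: p.1, p.2) | p <- tens_repr t].

Lemma tens_map_scale a s t : tens_rel s t ->
  tens_rel [seq (a *: p.1, p.2) | p <- s] [seq (a *: p.1, p.2) | p <- t].
Proof.
elim=> {s t}.
- by move=> s; apply: tens_refl.
- by move=> s t _; apply: tens_sym.
- by move=> s t r _ st _; apply: tens_trans.
- by move=> s s' t t' _ IHs _ IHt; rewrite !map_cat; apply: tens_cat.
- by move=> s t; rewrite !map_cat; apply: tens_catC.
- by move=> v /=; rewrite scaler0; apply: tens_zero.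
- by move=> u u' v /=; rewrite scalerDr; apply: tens_addl.
- by move=> u v v' /=; apply: tens_addr.
- by move=> b u v /=; rewrite scalerA mulrC -scalerA; apply: tens_scale.
Qed.

Lemma tens_addE s t : tens_add (tens_class s) (tens_class t) = tens_class (s ++ t).
Proof. by apply/tens_classP/tens_cat; apply: tens_repr_class. Qed.

Lemma tens_scalingE a s :
  tens_scaling a (tens_class s) = tens_class [seq (a *: p.1, p.2) | p <- s].
Proof. by apply/tens_classP/tens_map_scale/tens_repr_class. Qed.

Lemma tens_ind (P : tens -> Prop) : (forall s, P (tens_class s)) -> forall t, P t.
Proof. by move=> Ps t; rewrite -(tens_reprK t). Qed.

Let add_A : associative tens_add.
Proof.
elim/tens_ind=> s; elim/tens_ind=> t; elim/tens_ind=> r.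
by rewrite !tens_addE catA.
Qed.

Let add_C : commutative tens_add.
Proof.
elim/tens_ind=> s; elim/tens_ind=> t.
by rewrite !tens_addE; apply/tens_classP/tens_catC.
Qed.

Let add_0 : left_id (tens_class [::]) tens_add.
Proof. by elim/tens_ind=> s; rewrite tens_addE. Qed.

Lemma tens_cons u v s : tens_class ((u, v) :: s) = tens_add (tensor u v) (tens_class s).
Proof. by rewrite tens_addE. Qed.

Lemma tens_scaling_cons a u v s : tens_scaling a (tens_class ((u, v) :: s)) =
  tens_add (tensor (a *: u) v) (tens_scaling a (tens_class s)).
Proof. by rewrite !tens_scalingE tens_addE. Qed.

Let tensor_D u u' v : tensor (u + u') v = tens_add (tensor u v) (tensor u' v).
Proof. by rewrite tens_addE; apply/tens_classP/tens_addl. Qed.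

Let tensor_0 v : tensor 0 v = tens_class [::].
Proof. exact/tens_classP/tens_zero. Qed.

Let scale_D a b t :
  tens_scaling (a + b) t = tens_add (tens_scaling a t) (tens_scaling b t).
Proof.
elim/tens_ind: t; elim=> [|[u v] s IHs]; first by rewrite !tens_scalingE add_0.
rewrite !tens_scaling_cons IHs scalerDl tensor_D -!add_A; congr tens_add.
by rewrite add_C -add_A; congr tens_add; apply: add_C.
Qed.

Let scale_0 t : tens_scaling 0 t = tens_class [::].
Proof.
elim/tens_ind: t; elim=> [|[u v] s IHs]; first by rewrite !tens_scalingE.
by rewrite tens_scaling_cons IHs scale0r tensor_0 add_0.
Qed.

Let scale_1 : left_id 1 tens_scaling.
Proof.
elim/tens_ind; elim=> [|[u v] s IHs]; first by rewrite !tens_scalingE.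
by rewrite tens_scaling_cons IHs scale1r tens_cons.
Qed.

Let add_N : left_inverse (tens_class [::]) (tens_scaling (-1)) tens_add.
Proof. by move=> t; rewrite -{2}[t]scale_1 -scale_D addNr scale_0. Qed.

HB.instance Definition _ := GRing.isZmodule.Build tens add_A add_C add_0 add_N.

Let scale_A a b t : tens_scaling a (tens_scaling b t) = tens_scaling (a * b) t.
Proof.
elim/tens_ind: t => s; rewrite !tens_scalingE -map_comp; congr tens_class.
by apply: eq_map => p /=; rewrite scalerA.
Qed.

Let scale_Dr : right_distributive tens_scaling +%R.
Proof.
move=> a; elim/tens_ind=> s; elim/tens_ind=> t.
by rewrite -[_ + _]/(tens_add _ _) tens_addE !tens_scalingE -[RHS]/(tens_add _ _) tens_addE map_cat.
Qed.

Let scale_Dl t : {morph tens_scaling^~ t : a b / a + b}.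
Proof. by move=> a b; apply: scale_D. Qed.

HB.instance Definition _ :=
  GRing.Zmodule_isLmodule.Build k tens scale_A scale_1 scale_Dr scale_Dl.

Lemma tens_classE s : tens_class s = \sum_(p <- s) tensor p.1 p.2.
Proof.
elim: s => [|[u v] s IHs]; first by rewrite big_nil.
by rewrite big_cons /= -IHs tens_cons.
Qed.

Lemma tensE t : t = \sum_(p <- tens_repr t) tensor p.1 p.2.
Proof. by rewrite -tens_classE tens_reprK. Qed.

Lemma tensorDl v : {morph tensor^~ v : u u' / u + u'}.
Proof. by move=> u u'; apply: tensor_D. Qed.

Lemma tensorDr u : {morph tensor u : v v' / v + v'}.
Proof.
by move=> v v'; rewrite /GRing.add /= tens_addE; apply/tens_classP/tens_addr.
Qed.

Lemma tensorZl a u v : tensor (a *: u) v = a *: tensor u v.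
Proof. by rewrite -[RHS]/(tens_scaling _ _) tens_scalingE. Qed.

Lemma tensorZr a u v : tensor u (a *: v) = a *: tensor u v.
Proof.
by rewrite -tensorZl; apply/tens_classP/tens_sym/tens_scale.
Qed.

End TensorProduct.

Arguments tens {k} (U V)%_type.

Definition bilin (k : fieldType) (U V W : lmodType k) (f : U -> V -> W) : Prop :=
  (forall u, linear (f u)) /\ (forall v, linear (f ^~ v)).

(* Sweedler sums: [\tsum_(u, v <- t) f u v] is the sum of the [f ui vi] for some
   expression of [t] as the sum of the [ui ⊗ vi]. When [f] is bilinear this is
   independent of the chosen expression, and is the linear map on [U ⊗ V]
   induced by [f] (see [tsum_tensor], [tsum_linear] and [tsum_unique]). *)
Definition tsum (k : fieldType) (U V : lmodType k) (W : nmodType)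
    (f : U -> V -> W) (t : tens U V) : W :=
  \sum_(p <- tens_repr t) f p.1 p.2.

Notation "U ⊗ V" := (tens U V)
  (at level 45, right associativity) : type_scope.
Notation "u ⊗ v" := (tensor u v)
  (at level 45, right associativity) : ring_scope.
Notation "\tsum_ ( a , b <- t ) e" := (tsum (fun a b => e) t)
  (at level 46, a binder, b binder, t at level 200, e at level 46,
   format "'[' \tsum_ ( a ,  b  <-  t ) '/  '  e ']'") : ring_scope.
Notation "\tsum_ ( a , b , c <- t ) e" :=
  (tsum (fun a => tsum (fun b c => e)) t)
  (at level 46, a binder, b binder, c binder, t at level 200, e at level 46,
   format "'[' \tsum_ ( a ,  b ,  c  <-  t ) '/  '  e ']'") : ring_scope.

Section TensorTheory.
Variables (k : fieldType) (U V : lmodType k).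

Lemma bilin_tensor : bilin (@tensor k U V).
Proof.
split=> [u a v v'|v a u u'] /=; first by rewrite tensorDr tensorZr.
by rewrite tensorDl tensorZl.
Qed.

Lemma tensor0l (v : V) : (0 : U) ⊗ v = 0.
Proof. by rewrite -[X in X ⊗ _](scale0r 0) tensorZl scale0r. Qed.

Lemma tensor0r (u : U) : u ⊗ (0 : V) = 0.
Proof. by rewrite -[X in _ ⊗ X](scale0r 0) tensorZr scale0r. Qed.

Lemma tens_elim (P : U ⊗ V -> Prop) :
  (forall u v, P (u ⊗ v)) -> (forall s t, P s -> P t -> P (s + t)) ->
  forall t, P t.
Proof.
move=> P1 PD t; rewrite (tensE t); elim: (tens_repr t) => [|p s IHs].
  by rewrite big_nil -(tensor0l 0).
by rewrite big_cons; apply: PD.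
Qed.

End TensorTheory.

Section LinearFacts.
Variables (k : fieldType) (U V : lmodType k) (f : U -> V).
Hypothesis f_lin : linear f.

Lemma linearD_of u v : f (u + v) = f u + f v.
Proof. by have := f_lin 1 u v; rewrite !scale1r. Qed.

Lemma linear0_of : f 0 = 0.
Proof. by apply: (addrI (f 0)); rewrite -linearD_of !addr0. Qed.

Lemma linearZ_of a u : f (a *: u) = a *: f u.
Proof. by have := f_lin a u 0; rewrite linear0_of !addr0. Qed.

End LinearFacts.

Section TensorSum.
Variables (k : fieldType) (U V W : lmodType k) (f : U -> V -> W).
Hypothesis f_bilin : bilin f.

Lemma tsum_class s : tsum f (tens_class s) = \sum_(p <- s) f p.1 p.2.
Proof.
have [fr fl] := f_bilin.
suff fE s1 s2 : tens_rel s1 s2 ->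
    \sum_(p <- s1) f p.1 p.2 = \sum_(p <- s2) f p.1 p.2.
  exact/fE/tens_repr_class.
elim=> {s s1 s2} //=.
- by move=> s t r _ -> _ ->.
- by move=> s s' t t' _ IHs _ IHt; rewrite !big_cat IHs IHt.
- by move=> s t; rewrite !big_cat /= addrC.
- by move=> v; rewrite big_seq1 big_nil (linear0_of (fl v)).
- by move=> u u' v; rewrite !big_cons !big_nil !addr0 (linearD_of (fl v)).
- by move=> u v v'; rewrite !big_cons !big_nil !addr0 (linearD_of (fr u)).
by move=> a u v; rewrite !big_seq1 (linearZ_of (fl v)) (linearZ_of (fr u)).
Qed.

Lemma tsum_tensor u v : tsum f (u ⊗ v) = f u v.
Proof. by rewrite tsum_class big_seq1. Qed.

Lemma tsum_linear : linear (tsum f).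
Proof.
have [fr fl] := f_bilin.
move=> a s t; rewrite -{1}(tens_reprK s) -{1}(tens_reprK t).
rewrite -[_ + _]/(tens_add _ _) -[a *: _]/(tens_scaling _ _).
rewrite tens_scalingE tens_addE tsum_class big_cat big_map /=; congr (_ + _).
by rewrite scaler_sumr; apply: eq_bigr => p _; rewrite (linearZ_of (fl _)).
Qed.

Lemma tsum_unique (g : U ⊗ V -> W) :
  linear g -> (forall u v, g (u ⊗ v) = f u v) -> g =1 tsum f.
Proof.
move=> g_lin gE; elim/tens_elim=> [u v|s t gs gt].
  by rewrite gE tsum_tensor.
by rewrite (linearD_of g_lin) (linearD_of tsum_linear) gs gt.
Qed.

End TensorSum.

Lemma tens_ext (k : fieldType) (U V W : lmodType k) (f g : U ⊗ V -> W) :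
  linear f -> linear g -> (forall u v, f (u ⊗ v) = g (u ⊗ v)) -> f =1 g.
Proof.
move=> f_lin g_lin fg; elim/tens_elim=> // s t fs ft.
by rewrite (linearD_of f_lin) (linearD_of g_lin) fs ft.
Qed.

Lemma linear_functional (k : fieldType) (V : lmodType k) (v : V) :
  v != 0 -> exists f : V -> k^o, linear f /\ f v = 1.
Proof.
move=> v0; pose P : set (set V) := fun W =>
  ~ W v /\ (forall a x y, W x -> W y -> W (a *: x + y)).
have [F FP Ftot|W [[Wv Wlin] Wmax]] := @Zorn_bigcup V P.
  split=> [[X FX Xv]|a x y [X FX Xx] [Y FY Yy]]; first by case: (FP X FX).
  have [XY|YX] := Ftot X Y FX FY.
    by exists Y => //; apply: (FP Y FY).2 => //; apply: XY.
  by exists X => //; apply: (FP X FX).2 => //; apply: YX.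
have W0 : W 0.
  apply: contrapT => W0; case: (pselect (exists x, W x)) => [[x Wx]|W_].
    by apply: W0; rewrite -[0](addNr x) -scaleN1r; apply: Wlin.
  apply: (Wmax [set 0]%classic).
    by split=> [x Wx|/(_ 0 erefl)//]; case: W_; exists x.
  split=> [/= v_0|a x y /= -> ->]; first by rewrite v_0 eqxx in v0.
  by rewrite scaler0 addr0.
have WZ a x : W x -> W (a *: x) by move=> Wx; rewrite -[_ *: _]addr0; apply: Wlin.
have WD x y : W x -> W y -> W (x + y).
  by move=> Wx; rewrite -[x in x + y]scale1r; apply: Wlin.
have decomp x : exists a, W (x - a *: v).
  apply: contrapT => Wx.
  pose W' := [set y | exists b w, W w /\ y = w + b *: x]%classic.
  apply: (Wmax W'); first split.
  - by move=> w Ww; exists 0, w; rewrite scale0r addr0.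
  - move=> W'W; apply: Wx; exists 0; rewrite scale0r subr0; apply: W'W.
    by exists 1, 0; rewrite scale1r add0r.
  split.
    move=> [b [w [Ww vE]]]; apply: Wx.
    have [b0|b0] := eqVneq b 0.
      by case: Wv; rewrite vE b0 scale0r addr0.
    exists b^-1; rewrite vE scalerDr scalerA mulVf // scale1r opprD addrC.
    by rewrite addrNK -scaleN1r; apply/WZ/WZ.
  move=> c y z [b [w [Ww ->]]] [b' [w' [Ww' ->]]].
  exists (c * b + b'), (c *: w + w'); split; first exact: Wlin.
  by rewrite scalerDr scalerA scalerDl addrACA.
have uniq_coef x a b : W (x - a *: v) -> W (x - b *: v) -> a = b.
  move=> Wa Wb; apply/eqP; rewrite -subr_eq0; apply: contrapT => /negP ab0.
  apply: Wv; have -> : v = (a - b)^-1 *: ((x - b *: v) + (-1) *: (x - a *: v)).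
    by rewrite scaleN1r opprB [X in _ *: X]addrC addrA subrK -scalerBl scalerA mulVf ?scale1r.
  by apply/WZ/WD => //; exact: WZ.
pose f x : k^o := projT1 (cid (decomp x)).
have fP x : W (x - f x *: v) by rewrite /f; case: cid.
exists f; split=> [a x y|].
  apply: (uniq_coef (a *: x + y)) => //; rewrite scalerDl opprD addrACA -scalerA.
  by rewrite -scalerBr; apply: Wlin.
by apply: (uniq_coef v) => //; rewrite scale1r subrr.
Qed.

Section TensorAlgebra.
Variables (k : fieldType) (A B : algType k).

Definition tens_mul (s t : A ⊗ B) : A ⊗ B :=
  \tsum_(a, b <- s) \tsum_(c, d <- t) (a * c) ⊗ (b * d).

Let mul_bilin2 a b : bilin (fun (c : A) (d : B) => (a * c) ⊗ (b * d)).
Proof.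
split=> [c x d d'|d x c c'] /=.
  by rewrite mulrDr -scalerAr tensorDr tensorZr.
by rewrite mulrDr -scalerAr tensorDl tensorZl.
Qed.

Let mul_bilin1 (t : A ⊗ B) :
  bilin (fun (a : A) (b : B) => \tsum_(c, d <- t) (a * c) ⊗ (b * d)).
Proof.
split=> [a x b b'|b x a a'] /=.
  rewrite /tsum scaler_sumr -big_split; apply: eq_bigr => p _ /=.
  by rewrite mulrDl -scalerAl tensorDr tensorZr.
rewrite /tsum scaler_sumr -big_split; apply: eq_bigr => p _ /=.
by rewrite mulrDl -scalerAl tensorDl tensorZl.
Qed.

Lemma tens_mulE a b c d : tens_mul (a ⊗ b) (c ⊗ d) = (a * c) ⊗ (b * d).
Proof.
by rewrite /tens_mul (tsum_tensor (mul_bilin1 _)) (tsum_tensor (mul_bilin2 _ _)).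
Qed.

Let tens_mul_linl t : linear (tens_mul^~ t).
Proof. exact: tsum_linear. Qed.

Let tens_mul_linr s : linear (tens_mul s).
Proof.
move=> x t t'.
have E r : tens_mul s r = \sum_(p <- tens_repr s)
    tsum (fun c d => (p.1 * c) ⊗ (p.2 * d)) r by [].
rewrite !E scaler_sumr -big_split; apply: eq_bigr => p _ /=.
exact: (tsum_linear (mul_bilin2 _ _)).
Qed.

Let mulDl : left_distributive tens_mul +%R.
Proof. by move=> s s' t; apply: (linearD_of (tens_mul_linl t)). Qed.

Let mulDr : right_distributive tens_mul +%R.
Proof. by move=> s t t'; apply: (linearD_of (tens_mul_linr s)). Qed.

Let mulA : associative tens_mul.
Proof.
elim/tens_elim=> [a b|s s' IHs IHs']; last by move=> t r; rewrite !mulDl IHs IHs'.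
elim/tens_elim=> [c d|t t' IHt IHt']; last first.
  by move=> r; rewrite mulDl !mulDr mulDl IHt IHt'.
elim/tens_elim=> [e f|r r' IHr IHr']; last by rewrite !mulDr IHr IHr'.
by rewrite !tens_mulE !mulrA.
Qed.

Let mul1 : left_id (1 ⊗ 1) tens_mul.
Proof.
elim/tens_elim=> [a b|s t IHs IHt]; last by rewrite mulDr IHs IHt.
by rewrite tens_mulE !mul1r.
Qed.

Let mulr1_ : right_id (1 ⊗ 1) tens_mul.
Proof.
elim/tens_elim=> [a b|s t IHs IHt]; last by rewrite mulDl IHs IHt.
by rewrite tens_mulE !mulr1.
Qed.

Let one_neq0 : (1 : A) ⊗ (1 : B) != 0.
Proof.
have [f [f_lin f1]] := linear_functional (oner_neq0 A).
have [g [g_lin g1]] := linear_functional (oner_neq0 B).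
have fg_bilin : bilin (fun a b => f a * g b : k^o).
  split=> [a x b b'|b x a a'] /=.
    by rewrite g_lin mulrDr -scalerAr.
  by rewrite f_lin mulrDl -scalerAl.
apply/eqP => /(congr1 (tsum (fun a b => f a * g b : k^o))).
rewrite (tsum_tensor fg_bilin) (linear0_of (tsum_linear fg_bilin)) f1 g1 mulr1.
by move/eqP; rewrite oner_eq0.
Qed.

HB.instance Definition _ := GRing.Zmodule_isNzRing.Build (A ⊗ B)%type
  mulA mul1 mulr1_ mulDl mulDr one_neq0.

Let scaleAl (a : k) (s t : A ⊗ B) : a *: (s * t) = (a *: s) * t.
Proof. by rewrite -[RHS]/(tens_mul _ _) (linearZ_of (tens_mul_linl t)). Qed.

Let scaleAr (a : k) (s t : A ⊗ B) : a *: (s * t) = s * (a *: t).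
Proof. by rewrite -[RHS]/(tens_mul _ _) (linearZ_of (tens_mul_linr s)). Qed.

HB.instance Definition _ := GRing.Lmodule_isLalgebra.Build k (A ⊗ B)%type scaleAl.
HB.instance Definition _ := GRing.Lalgebra_isAlgebra.Build k (A ⊗ B)%type scaleAr.

Lemma tensorM (a c : A) (b d : B) : (a ⊗ b) * (c ⊗ d) = (a * c) ⊗ (b * d).
Proof. exact: tens_mulE. Qed.

Lemma tensor1 : (1 : A ⊗ B) = 1 ⊗ 1.
Proof. by []. Qed.

End TensorAlgebra.

Definition tmap (k : fieldType) (U U' V V' : lmodType k)
    (f : U -> U') (g : V -> V') (t : U ⊗ V) : U' ⊗ V' :=
  \tsum_(u, v <- t) f u ⊗ g v.

Definition tassoc (k : fieldType) (U V W : lmodType k) (t : (U ⊗ V) ⊗ W) :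
    U ⊗ V ⊗ W :=
  \tsum_(p, w <- t) \tsum_(u, v <- p) u ⊗ v ⊗ w.

(* H ⊗ H ⊗ H is read H ⊗ (H ⊗ H), and [PhiV] is the inverse of [Phi]. *)
Record quasiBialgebra (k : fieldType) := QuasiBialgebra {
  qb_alg :> algType k;
  Delta : {lrmorphism qb_alg -> (qb_alg ⊗ qb_alg)%type};
  eps : {lrmorphism qb_alg -> k^o};
  Phi : qb_alg ⊗ qb_alg ⊗ qb_alg;
  PhiV : qb_alg ⊗ qb_alg ⊗ qb_alg;
  PhiK : Phi * PhiV = 1;
  PhiVK : PhiV * Phi = 1;
  Delta_coassoc : forall h,
    tmap id Delta (Delta h) = Phi * tassoc (tmap Delta id (Delta h)) * PhiV;
  Delta_counitr : forall h, \tsum_(h1, h2 <- Delta h) (eps h2 : k) *: h1 = h;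
  Delta_counitl : forall h, \tsum_(h1, h2 <- Delta h) (eps h1 : k) *: h2 = h;
  Phi_pentagon :
    (1 ⊗ Phi)
    * (\tsum_(X1, X2, X3 <- Phi) \tsum_(a, b <- Delta X2) X1 ⊗ a ⊗ b ⊗ X3)
    * (\tsum_(X1, X2, X3 <- Phi) X1 ⊗ X2 ⊗ X3 ⊗ 1)
    = (\tsum_(X1, X2, X3 <- Phi) X1 ⊗ X2 ⊗ Delta X3)
      * (\tsum_(X1, X2, X3 <- Phi) \tsum_(a, b <- Delta X1) a ⊗ b ⊗ X2 ⊗ X3)
      :> qb_alg ⊗ qb_alg ⊗ qb_alg ⊗ qb_alg;
  Phi_counit : tmap id (tmap eps id) Phi = 1 ⊗ 1 ⊗ 1
}.

(* [antip_bij], with [antip] linear, unital and anti-multiplicative, says that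
   [antip] is an algebra anti-automorphism; the last three axioms are the
   customary normalization of the antipode data. *)
Record quasiHopf (k : fieldType) := QuasiHopf {
  qh_bialg :> quasiBialgebra k;
  antip : {linear qh_bialg -> qh_bialg};
  antip_bij : bijective antip;
  antip1 : antip 1 = 1;
  antipM : forall g h, antip (g * h) = antip h * antip g;
  qh_alpha : qh_bialg;
  qh_beta : qh_bialg;
  antip_alpha : forall h, \tsum_(h1, h2 <- Delta qh_bialg h)
    antip h1 * qh_alpha * h2 = (eps qh_bialg h : k) *: qh_alpha;
  antip_beta : forall h, \tsum_(h1, h2 <- Delta qh_bialg h)
    h1 * qh_beta * antip h2 = (eps qh_bialg h : k) *: qh_beta;
  antip_Phi : \tsum_(X1, X2, X3 <- Phi qh_bialg)
    X1 * qh_beta * antip X2 * qh_alpha * X3 = 1;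
  antip_PhiV : \tsum_(x1, x2, x3 <- PhiV qh_bialg)
    antip x1 * qh_alpha * x2 * qh_beta * antip x3 = 1;
  eps_alpha : eps qh_bialg qh_alpha = 1;
  eps_beta : eps qh_bialg qh_beta = 1;
  eps_antip : forall h, eps qh_bialg (antip h) = eps qh_bialg h
}.

Arguments Delta {k} _.
Arguments eps {k} _.

(* The operations of a Yetter-Drinfeld module, without the axioms, which form the
   predicate [is_yd]: tensor products can then be given by formulas, and the
   structure maps of algebras, coalgebras and Hopf modules required to be
   morphisms for these formulas. *)
Record ydData (k : fieldType) (H : quasiHopf k) := YDData {
  yd_car :> lmodType k;
  yd_act : H -> yd_car -> yd_car;
  yd_coact : yd_car -> H ⊗ yd_car
}.

Notation "h ▷ m" := (yd_act h m) (at level 42, right associativity) : ring_scope.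
Notation λ := (@yd_coact _ _ _).

Section YetterDrinfeld.
Variables (k : fieldType) (H : quasiHopf k).
Implicit Types L M N : ydData H.

Local Notation Δ := (Delta H).
Local Notation ε := (eps H).
Local Notation Φ := (Phi H).
Local Notation Φ' := (PhiV H).

Record is_yd M : Prop := IsYD {
  yd_act_bilin : bilin (@yd_act k H M);
  yd_act1 : forall m : M, 1 ▷ m = m;
  yd_actM : forall g h (m : M), (g * h) ▷ m = g ▷ h ▷ m;
  yd_coact_linear : linear (@yd_coact k H M);
  yd_coassoc : forall m : M,
    \tsum_(X1, X2, X3 <- Φ) \tsum_(a, m0 <- λ m) \tsum_(b, m00 <- λ (X2 ▷ m0))
      (X1 * a) ⊗ (b * X3) ⊗ m00
    = \tsum_(X1, X2, X3 <- Φ) \tsum_(Y1, Y2, Y3 <- Φ)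
      \tsum_(a, m0 <- λ (Y1 ▷ m)) \tsum_(a1, a2 <- Δ a)
        (X1 * a1 * Y2) ⊗ (X2 * a2 * Y3) ⊗ (X3 ▷ m0);
  yd_counit : forall m : M, \tsum_(a, m0 <- λ m) (ε a : k) *: m0 = m;
  yd_compat : forall h (m : M),
    \tsum_(h1, h2 <- Δ h) \tsum_(a, m0 <- λ m) (h1 * a) ⊗ (h2 ▷ m0)
    = \tsum_(h1, h2 <- Δ h) \tsum_(a, m0 <- λ (h1 ▷ m)) (a * h2) ⊗ m0
}.

Record is_yd_mor M N (f : M -> N) : Prop := IsYDMor {
  yd_mor_linear : linear f;
  yd_mor_act : forall h m, f (h ▷ m) = h ▷ f m;
  yd_mor_coact : forall m, λ (f m) = tmap id f (λ m)
}.

Definition yd_unit : ydData H :=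
  @YDData k H k^o (fun h a => ε h * a) (fun a => 1 ⊗ a).

Definition yd_tens M N : ydData H :=
  @YDData k H (M ⊗ N)%type
    (fun h t => \tsum_(m, n <- t) \tsum_(h1, h2 <- Δ h) (h1 ▷ m) ⊗ (h2 ▷ n))
    (fun t => \tsum_(m, n <- t)
      \tsum_(X1, X2, X3 <- Φ) \tsum_(x1, x2, x3 <- Φ') \tsum_(Y1, Y2, Y3 <- Φ)
      \tsum_(a, m0 <- λ ((x1 * Y1) ▷ m)) \tsum_(b, n0 <- λ (Y2 ▷ n))
        (X1 * a * x2 * b * Y3) ⊗ (X2 ▷ m0) ⊗ ((X3 * x3) ▷ n0)).

Definition yd_assoc L M N (t : (L ⊗ M) ⊗ N) : L ⊗ M ⊗ N :=
  \tsum_(p, n <- t) \tsum_(l, m <- p) \tsum_(X1, X2, X3 <- Φ)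
    (X1 ▷ l) ⊗ (X2 ▷ m) ⊗ (X3 ▷ n).

End YetterDrinfeld.

Arguments is_yd_mor {k H} M N f.

Record hopfData (k : fieldType) (H : quasiHopf k) := HopfData {
  hd_yd :> ydData H;
  hd_mul : hd_yd ⊗ hd_yd -> hd_yd;
  hd_unit : k -> hd_yd;
  hd_comul : hd_yd -> hd_yd ⊗ hd_yd;
  hd_counit : hd_yd -> k;
  hd_antip : hd_yd -> hd_yd
}.

Definition hd_one (k : fieldType) (H : quasiHopf k) (B : hopfData H) : B :=
  hd_unit B 1.

Notation "b ∙ c" := (hd_mul (b ⊗ c)) (at level 40, left associativity) : ring_scope.

Section HopfAlgebra.
Variables (k : fieldType) (H : quasiHopf k).

Local Notation Δ := (Delta H).
Local Notation Φ := (Phi H).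
Local Notation Φ' := (PhiV H).

(* For [M = B] and [r] the multiplication of [B], this is the multiplication of
   the tensor product algebra [B ⊗ B] in the braided category; in general it is
   the action on [M ⊗ B] of the algebra [B ⊗ B]. *)
Definition braided_act (B : hopfData H) (M : ydData H) (r : M ⊗ B -> M)
    (s : M ⊗ B) (t : B ⊗ B) : M ⊗ B :=
  \tsum_(m, b <- s) \tsum_(c, d <- t)
  \tsum_(X1, X2, X3 <- Φ) \tsum_(x1, x2, x3 <- Φ')
  \tsum_(y1, y2, y3 <- Φ') \tsum_(Y1, Y2, Y3 <- Φ)
  \tsum_(X31, X32 <- Δ X3) \tsum_(y31, y32 <- Δ y3)
  \tsum_(a, b0 <- λ ((x1 * X2) ▷ b))
    r (((y1 * X1) ▷ m) ⊗ ((y2 * Y1 * a * x2 * X31) ▷ c))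
    ⊗ (((y31 * Y2) ▷ b0) ∙ ((y32 * Y3 * x3 * X32) ▷ d)).

Record is_hopf (B : hopfData H) : Prop := IsHopf {
  hopf_yd : is_yd B;
  hopf_mul_mor : is_yd_mor (yd_tens B B) B (@hd_mul k H B);
  hopf_unit_mor : is_yd_mor (yd_unit H) B (@hd_unit k H B);
  hopf_mulA : forall a b c : B,
    (a ∙ b) ∙ c = \tsum_(X1, X2, X3 <- Φ) (X1 ▷ a) ∙ ((X2 ▷ b) ∙ (X3 ▷ c));
  hopf_mul1l : forall b : B, hd_one B ∙ b = b;
  hopf_mul1r : forall b : B, b ∙ hd_one B = b;
  hopf_comul_mor : is_yd_mor B (yd_tens B B) (@hd_comul k H B);
  hopf_counit_mor : is_yd_mor B (yd_unit H) (@hd_counit k H B);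
  hopf_coassoc : forall b : B,
    yd_assoc (tmap (@hd_comul k H B) id (hd_comul b))
    = tmap id (@hd_comul k H B) (hd_comul b);
  hopf_counitl : forall b : B,
    \tsum_(b1, b2 <- hd_comul b) hd_counit b1 *: b2 = b;
  hopf_counitr : forall b : B,
    \tsum_(b1, b2 <- hd_comul b) hd_counit b2 *: b1 = b;
  hopf_comul1 : hd_comul (hd_one B) = hd_one B ⊗ hd_one B;
  hopf_comulM : forall b c : B,
    hd_comul (b ∙ c) = braided_act (@hd_mul k H B) (hd_comul b) (hd_comul c);
  hopf_counit1 : hd_counit (hd_one B) = 1;
  hopf_counitM : forall b c : B, hd_counit (b ∙ c) = hd_counit b * hd_counit c;
  hopf_antip_mor : is_yd_mor B B (@hd_antip k H B);
  hopf_antipl : forall b : B,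
    \tsum_(b1, b2 <- hd_comul b) hd_antip b1 ∙ b2 = hd_counit b *: hd_one B;
  hopf_antipr : forall b : B,
    \tsum_(b1, b2 <- hd_comul b) b1 ∙ hd_antip b2 = hd_counit b *: hd_one B
}.

Record hopfYD := HopfYD {
  hopf_data :> hopfData H;
  hopf_ax : is_hopf hopf_data
}.

End HopfAlgebra.

Record hmodData (k : fieldType) (H : quasiHopf k) (B : hopfYD H) := HModData {
  hm_yd :> ydData H;
  hm_act : hm_yd ⊗ B -> hm_yd;
  hm_coact : hm_yd -> hm_yd ⊗ B
}.

Notation "m ↼ b" := (hm_act (m ⊗ b)) (at level 43, left associativity) : ring_scope.
Notation ρ := (@hm_coact _ _ _ _).

Section HopfModules.
Variables (k : fieldType) (H : quasiHopf k) (B : hopfYD H).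
Implicit Types M N : hmodData B.

Local Notation Φ := (Phi H).
Local Notation Φ' := (PhiV H).

Record is_hmod M : Prop := IsHMod {
  hm_is_yd : is_yd M;
  hm_act_mor : is_yd_mor (yd_tens M B) M (@hm_act k H B M);
  hm_coact_mor : is_yd_mor M (yd_tens M B) (@hm_coact k H B M);
  hm_act1 : forall m : M, m ↼ hd_one B = m;
  hm_actA : forall (m : M) (b c : B),
    (m ↼ b) ↼ c = \tsum_(X1, X2, X3 <- Φ) (X1 ▷ m) ↼ ((X2 ▷ b) ∙ (X3 ▷ c));
  hm_coassoc : forall m : M,
    yd_assoc (tmap (@hm_coact k H B M) id (ρ m))
    = tmap id (@hd_comul k H B) (ρ m);
  hm_counit : forall m : M, \tsum_(m0, m1 <- ρ m) hd_counit m1 *: m0 = m;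
  hm_compat : forall (m : M) (b : B),
    ρ (m ↼ b) = braided_act (@hm_act k H B M) (ρ m) (hd_comul b)
}.

Record is_hmod_mor M N (f : M -> N) : Prop := IsHModMor {
  hm_mor_yd : is_yd_mor M N f;
  hm_mor_act : forall m b, f (m ↼ b) = f m ↼ b;
  hm_mor_coact : forall m, ρ (f m) = tmap f id (ρ m)
}.

(* The free Hopf module N ⊗ B. *)
Definition hm_tens (N : ydData H) : hmodData B :=
  @HModData k H B (yd_tens N B)
    (fun t => \tsum_(p, c <- t) \tsum_(n, b <- p) \tsum_(X1, X2, X3 <- Φ)
      (X1 ▷ n) ⊗ ((X2 ▷ b) ∙ (X3 ▷ c)))
    (fun t => \tsum_(n, b <- t) \tsum_(b1, b2 <- hd_comul b)
      \tsum_(x1, x2, x3 <- Φ') ((x1 ▷ n) ⊗ (x2 ▷ b1)) ⊗ (x3 ▷ b2)).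

Record hopfModule := HopfModule {
  hm_data :> hmodData B;
  hm_ax : is_hmod hm_data
}.

Definition hm_proj M (m : M) : M := \tsum_(m0, m1 <- ρ m) m0 ↼ hd_antip m1.

Definition coinv M : {pred M} := [pred m : M | `[< ρ m = m ⊗ hd_one B >]].

Arguments coinv M : clear implicits.

Lemma coinvP M (m : M) : reflect (ρ m = m ⊗ hd_one B) (m \in coinv M).
Proof. exact: asboolP. Qed.

Section Coinvariants.
Variable M : hopfModule.

Let ρ_lin : linear (@hm_coact k H B M).
Proof. exact: yd_mor_linear (hm_coact_mor (hm_ax M)). Qed.

Lemma coinv_submod : GRing.subsemimod_closed (coinv M).
Proof.
split; [split|].
- by apply/coinvP; rewrite (linear0_of ρ_lin) tensor0l.
- move=> m n /coinvP hm /coinvP hn; apply/coinvP.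
  by rewrite (linearD_of ρ_lin) hm hn tensorDl.
by move=> a m /coinvP hm; apply/coinvP; rewrite (linearZ_of ρ_lin) hm tensorZl.
Qed.

HB.instance Definition _ := GRing.isSubmodClosed.Build k M (coinv M) coinv_submod.

Record coinvT := CoinvT { coinv_val :> M; _ : coinv_val \in coinv M }.

HB.instance Definition _ := [isSub for coinv_val].
HB.instance Definition _ := [Choice of coinvT by <:].
HB.instance Definition _ := [SubChoice_isSubLmodule of coinvT by <:].

End Coinvariants.

End HopfModules.

Arguments coinv {k H B} M.
Arguments is_hmod_mor {k H B} M N f.

(* Main.v *)
(* The structure theorem holds for formal reasons in a braided category; what has
   to be controlled is the reassociation by Φ.

   Let T : M ⊗ B → M ⊗ B be the Galois map m ⊗ b ↦ (m ↼ b1) ⊗ b2.  The key identity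
   is T(m ⊗ b)·Δ(c) = T(m ⊗ bc), for the action · of B ⊗ B on M ⊗ B.  Only one
   crossing occurs in it, on the same pair of strands on both sides, so that it
   follows from the pentagon and from naturality, without the hexagon axioms.
   Since P(m0) ↼ m1 = m, one gets T(P(m0) ⊗ m1) = ρ(m), hence
     ρ(P(m)) = ρ(m0)·Δ(S(m1)) = T(P(m00) ⊗ m01 S(m1)) = T(P(m) ⊗ 1) = P(m) ⊗ 1;
   in particular the antipode need not be shown to be anti-comultiplicative.

   P is a composite of morphisms of Yetter-Drinfeld modules and restricts to the
   identity on the coinvariants, which makes these a Yetter-Drinfeld submodule, with
   coaction (id ⊗ P) λ.  Finally the maps F and G are inverse to each other and F
   preserves all the operations, so that the axioms of a Hopf module for the
   coinvariants tensored with B are transported from M along F. *)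

Require Import Defs.
From mathcomp Require Import all_boot all_order all_algebra.
From mathcomp Require Import boolp.

Set Implicit Arguments.
Unset Strict Implicit.
Unset Printing Implicit Defensive.

Import GRing.Theory.
Local Open Scope ring_scope.

(** * Tensor calculus *)

Section LinearFunctions.
Variable k : fieldType.
Implicit Types U V W X : lmodType k.

Lemma lin_id U : linear (@id U).
Proof. by []. Qed.

Lemma lin_comp U V W (g : V -> W) (f : U -> V) :
  linear g -> linear f -> linear (fun u => g (f u)).
Proof. by move=> g_lin f_lin a u v; rewrite f_lin g_lin. Qed.

Lemma lin_bilinl U V W X (g : V -> W -> X) (f : U -> V) w :
  bilin g -> linear f -> linear (fun u => g (f u) w).
Proof. by case=> _ g_lin f_lin; apply: (lin_comp (g_lin w) f_lin). Qed.

Lemma lin_bilinr U V W X (g : V -> W -> X) (f : U -> W) v :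
  bilin g -> linear f -> linear (fun u => g v (f u)).
Proof. by case=> g_lin _ f_lin; apply: (lin_comp (g_lin v) f_lin). Qed.

(** The chosen representative of [t] does not vary with [u], so this is linearity of a finite
    sum. *)
Lemma lin_tsum U V W X (f : U -> V -> W -> X) t :
  (forall v w, linear (fun u => f u v w)) -> linear (fun u => tsum (f u) t).
Proof.
move=> f_lin a u u'; rewrite /tsum scaler_sumr -big_split.
by apply: eq_bigr => p _; rewrite f_lin.
Qed.

Lemma lin_tsumr U V W X (f : V -> W -> X) (g : U -> (V ⊗ W)%type) :
  bilin f -> linear g -> linear (fun u => tsum f (g u)).
Proof. by move=> f_bilin; apply/lin_comp/tsum_linear. Qed.

Lemma lin_scale U V a (f : U -> V) : linear f -> linear (fun u => a *: f u).
Proof. by move=> f_lin b u v; rewrite f_lin scalerDr !scalerA mulrC. Qed.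

Lemma bilin_scale V : bilin (fun (a : k^o) (v : V) => (a : k) *: v).
Proof.
split=> [a b u v|v b a a'] /=; first by rewrite scalerDr !scalerA mulrC.
by rewrite scalerDl scalerA.
Qed.

Lemma lin_scalel U V (f : U -> k^o) (v : V) :
  linear f -> linear (fun u => (f u : k) *: v).
Proof. by move=> f_lin a u u'; rewrite f_lin scalerDl -scalerA. Qed.

Lemma bilin_mul (A : algType k) : bilin (fun a b : A => a * b).
Proof.
split=> [a x b b'|b x a a'] /=; first by rewrite mulrDr scalerAr.
by rewrite mulrDl scalerAl.
Qed.

Lemma lin_tsum_comm U V W X (g : W -> X) (f : U -> V -> W) t :
  linear g -> g (tsum f t) = tsum (fun u v => g (f u v)) t.
Proof.
move=> g_lin; rewrite /tsum; elim: (tens_repr t) => [|p s IHs].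
  by rewrite !big_nil (linear0_of g_lin).
by rewrite !big_cons (linearD_of g_lin) IHs.
Qed.

Lemma eq_tsum U V (W : nmodType) (f g : U -> V -> W) t :
  (forall u v, f u v = g u v) -> tsum f t = tsum g t.
Proof. by move=> fg; apply: eq_bigr => p _. Qed.

End LinearFunctions.

Create HintDb lin.

Ltac lin_atom :=
  first [ assumption | solve [eauto 8 with lin nocore] | exact: linearP
        | match goal with h : _ |- _ => exact: h end ].

(* Solves [linear] and [bilin] goals on expressions that are linear in the bound
   variable by construction; the linearity of the maps occurring in them is
   looked up among the hypotheses and in the database [lin]. *)
Ltac lin :=
  cbv beta;
  lazymatch goal with
  | |- forall _, _ => intro; lin
  | |- bilin _ =>
    first [ exact: bilin_tensor | exact: bilin_scale | exact: bilin_mul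
          | lin_atom | split; intro; lin ]
  | |- GRing.linear_for _ (fun x => x) => exact: lin_id
  | |- GRing.linear_for _ (fun x => tsum (@?f x) (@?t x)) =>
    lazymatch t with
    | (fun _ => ?t0) => apply: (lin_tsum (f := f) t0); lin
    | _ => lazymatch f with
      (fun _ => ?f0) => apply: (lin_tsumr (f := f0) (g := t)); lin end
    end
  | |- GRing.linear_for _ (fun x => GRing.scale (@?a x) (@?v x)) =>
    lazymatch v with
    | (fun _ => ?v0) => apply: (lin_scalel v0 (f := a)); lin
    | _ => lazymatch a with (fun _ => ?a0) => apply: (lin_scale a0 (f := v)); lin end
    end
  | |- GRing.linear_for _ (fun x => ?h (@?f x) (@?g x)) =>
    first [ lazymatch g with
    | (fun _ => ?v) => apply: (lin_bilinl (g := h) (f := f) v); lin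
    | _ => lazymatch f with
      | (fun _ => ?u) =>
        (* Tried before bilinearity of [h], because a term such as [tmap f g x] also matches this
           pattern, with the map [g] in the role of [u]. *)
        first [ apply: (lin_comp (g := h u) (f := g)); [by lin_atom | lin]
              | apply: (lin_bilinr (g := h) (f := g) u); lin ]
      end
    end | lin_atom ]
  | |- GRing.linear_for _ (fun x => ?g (@?f x)) =>
    apply: (lin_comp (g := g) (f := f)); lin
  | |- GRing.linear_for _ (tsum _) => apply: tsum_linear; lin
  | |- GRing.linear_for _ (?f ?u) =>
    first [ lin_atom | change (linear (fun x => f u x)); lin ]
  | |- _ => lin_atom
  end.

(* [pure t] reduces an equality of two linear functions of [t] to the case where
   [t] is a pure tensor. *)
Ltac pure t :=
  lazymatch goal with
  | |- ?l = ?r =>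
    lazymatch (eval pattern t in l) with
    | ?f _ => lazymatch (eval pattern t in r) with
      | ?g _ => refine (@tens_ext _ _ _ _ f g _ _ _ t); [lin | lin | cbv beta]
      end
    end
  end.

Ltac teval := repeat (rewrite tsum_tensor; [|by lin]).

Section TensorMaps.
Variable k : fieldType.
Implicit Types U V W X : lmodType k.

Lemma tmap_linear U U' V V' (f : U -> U') (g : V -> V') :
  linear f -> linear g -> linear (tmap f g).
Proof. by move=> f_lin g_lin; rewrite /tmap; lin. Qed.

Lemma tmap_tensor U U' V V' (f : U -> U') (g : V -> V') u v :
  linear f -> linear g -> tmap f g (u ⊗ v) = f u ⊗ g v.
Proof. by move=> f_lin g_lin; rewrite /tmap; teval. Qed.

Lemma tassoc_linear U V W : linear (@tassoc k U V W).
Proof. by rewrite /tassoc; lin. Qed.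

Lemma tassoc_tensor U V W (u : U) (v : V) (w : W) :
  tassoc ((u ⊗ v) ⊗ w) = u ⊗ v ⊗ w.
Proof. by rewrite /tassoc; teval. Qed.

Definition tassocV U V W (t : (U ⊗ V ⊗ W)%type) : ((U ⊗ V) ⊗ W)%type :=
  \tsum_(u, v, w <- t) (u ⊗ v) ⊗ w.

Lemma tassocV_linear U V W : linear (@tassocV U V W).
Proof. by rewrite /tassocV; lin. Qed.

Lemma tassocV_tensor U V W (u : U) (v : V) (w : W) :
  tassocV (u ⊗ v ⊗ w) = (u ⊗ v) ⊗ w.
Proof. by rewrite /tassocV; teval. Qed.

End TensorMaps.

#[global] Hint Extern 0 (GRing.linear_for _ id) => exact: lin_id : lin.
#[global] Hint Extern 1 (GRing.linear_for _ (@tmap _ _ _ _ _ _ _)) =>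
  apply: tmap_linear; lin : lin.
#[global] Hint Extern 1 (GRing.linear_for _ (@tassoc _ _ _ _)) =>
  exact: tassoc_linear : lin.
#[global] Hint Extern 1 (GRing.linear_for _ (@tassocV _ _ _ _)) =>
  exact: tassocV_linear : lin.

(** * Componentwise action of a tensor product of algebras *)

Section TensorAction.
Variables (k : fieldType) (A A' : algType k) (U V : lmodType k).
Variables (f : A -> U -> U) (g : A' -> V -> V).
Hypotheses (f_bilin : bilin f) (g_bilin : bilin g).

Definition tact (T : (A ⊗ A')%type) (t : (U ⊗ V)%type) : (U ⊗ V)%type :=
  \tsum_(a, b <- T) tmap (f a) (g b) t.

Lemma tact_bilin : bilin tact.
Proof.
rewrite /tact; split=> [T|t]; first by lin.
by rewrite /tmap; lin.
Qed.

Lemma tact_tensor a b u v : tact (a ⊗ b) (u ⊗ v) = f a u ⊗ g b v.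
Proof. by rewrite /tact /tmap; teval. Qed.

End TensorAction.

#[global] Hint Extern 1 (bilin (@tact _ _ _ _ _ _ _)) => apply: tact_bilin; lin : lin.

(* Evaluates the outermost operations on pure tensors. *)
Ltac tsimp := repeat (cbv beta; first
  [ rewrite tsum_tensor; [|by lin]
  | rewrite tmap_tensor; [|by lin|by lin]
  | rewrite tact_tensor; [|by lin|by lin]
  | rewrite tassoc_tensor | rewrite tassocV_tensor | rewrite tensorM ]).

Section TensorMapTheory.
Variable k : fieldType.
Implicit Types U V W X : lmodType k.

Lemma tassocK U V W : cancel (@tassoc k U V W) (@tassocV k U V W).
Proof. by move=> t; pure t => s w; pure s => u v; tsimp. Qed.

Lemma tassocVK U V W : cancel (@tassocV k U V W) (@tassoc k U V W).
Proof. by move=> t; pure t => u s; pure s => v w; tsimp. Qed.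

Lemma tmap_comp U U' U'' V V' V'' (f' : U' -> U'') (g' : V' -> V'')
    (f : U -> U') (g : V -> V') t :
  linear f' -> linear g' -> linear f -> linear g ->
  tmap f' g' (tmap f g t) = tmap (fun u => f' (f u)) (fun v => g' (g v)) t.
Proof. by move=> *; pure t => u v; tsimp. Qed.

Lemma eq_tmap U U' V V' (f f' : U -> U') (g g' : V -> V') t :
  f =1 f' -> g =1 g' -> tmap f g t = tmap f' g' t.
Proof. by move=> ff gg; apply: eq_tsum => u v; rewrite ff gg. Qed.

Lemma tmap_id U V : tmap (@id U) (@id V) = id.
Proof. by apply: funext => t; pure t => u v; tsimp. Qed.

Lemma tmap_eq_id U V (f : U -> U) (g : V -> V) t :
  f =1 id -> g =1 id -> tmap f g t = t.
Proof. by move=> f1 g1; rewrite (eq_tmap t f1 g1) tmap_id. Qed.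

Lemma tmap_idr U U' U'' V (f' : U' -> U'') (f : U -> U') (t : (U ⊗ V)%type) :
  linear f' -> linear f -> tmap f' id (tmap f id t) = tmap (fun u => f' (f u)) id t.
Proof. by move=> *; pure t => u v; tsimp. Qed.

Lemma tmap_idl U V V' V'' (g' : V' -> V'') (g : V -> V') (t : (U ⊗ V)%type) :
  linear g' -> linear g -> tmap id g' (tmap id g t) = tmap id (fun v => g' (g v)) t.
Proof. by move=> *; pure t => u v; tsimp. Qed.

Lemma tmap_rl U U' U'' V V' (f' : U' -> U'') (f : U -> U') (g : V -> V') t :
  linear f' -> linear f -> linear g ->
  tmap f' g (tmap f id t) = tmap (fun u => f' (f u)) g t.
Proof. by move=> *; pure t => u v; tsimp. Qed.

Lemma tmap_mergel U U' V V' (f : U -> U') (g : V -> V') t :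
  linear f -> linear g -> tmap f id (tmap id g t) = tmap f g t.
Proof. by move=> *; pure t => u v; tsimp. Qed.

Lemma tmap_merger U U' V V' (f : U -> U') (g : V -> V') t :
  linear f -> linear g -> tmap id g (tmap f id t) = tmap f g t.
Proof. by move=> *; pure t => u v; tsimp. Qed.

Lemma tsum_tmap U U' V V' W (f : U -> U') (g : V -> V') (h : U' -> V' -> W) t :
  linear f -> linear g -> bilin h ->
  tsum h (tmap f g t) = \tsum_(u, v <- t) h (f u) (g v).
Proof. by move=> *; pure t => u v; tsimp. Qed.

End TensorMapTheory.

(** Bridge from algebra to modules: iterated, it turns an identity in a tensor power of [H]
    (quasi-coassociativity, the pentagon for Φ) into an identity between maps on tensor products of
    modules. *)
Lemma tactM (k : fieldType) (A A' : algType k) (U V : lmodType k)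
    (f : A -> U -> U) (g : A' -> V -> V) :
  bilin f -> bilin g ->
  (forall a b u, f (a * b) u = f a (f b u)) ->
  (forall a b v, g (a * b) v = g a (g b v)) ->
  forall S T t, tact f g (S * T) t = tact f g S (tact f g T t).
Proof.
move=> f_bilin g_bilin fM gM S T t.
by pure t => u v; pure S => a a'; pure T => b b'; tsimp; rewrite fM gM.
Qed.

(** * Modules over a quasi-bialgebra and their associator *)

Section HModules.
Variables (k : fieldType) (H : quasiHopf k).
Implicit Types U V W L : ydData H.

(** The module half of [is_yd], singled out because the associators depend on nothing else and
    because it passes to [yd_tens] directly. *)
Record hmodule U : Prop := HModule {
  hmodule_bilin : bilin (@yd_act k H U);
  hmodule1 : forall u : U, 1 ▷ u = u;
  hmoduleM : forall g h (u : U), (g * h) ▷ u = g ▷ h ▷ u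
}.

Record hlinear U V (f : U -> V) : Prop := HLinear {
  hlinear_lin : linear f;
  hlinearE : forall h u, f (h ▷ u) = h ▷ f u
}.

End HModules.

Arguments hlinear {k H} U V f.

#[global] Hint Extern 1 (bilin (@yd_act _ _ _)) => apply: hmodule_bilin; lin : lin.
#[global] Hint Extern 2 (GRing.linear_for _ _) =>
  match goal with h : hlinear _ _ _ |- _ => exact: (hlinear_lin h) end : lin.

Section TensorModules.
Variables (k : fieldType) (H : quasiHopf k).
Implicit Types U V W L : ydData H.

Local Notation Δ := (Delta H).
Local Notation act := (@yd_act k H _).

Lemma id_hlinear U : hlinear U U id.
Proof. by split. Qed.

Lemma hlinear_comp U V W (g : V -> W) (f : U -> V) :
  hlinear V W g -> hlinear U V f -> hlinear U W (fun u => g (f u)).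
Proof. by move=> hg hf; split=> [|h u]; [lin | rewrite !hlinearE]. Qed.

Lemma tens_act U V h (t : yd_tens U V) : hmodule U -> hmodule V ->
  h ▷ t = tact act act (Δ h) t.
Proof.
by move=> hU hV; rewrite /=; pure t => u v; tsimp; pure (Δ h) => a b; tsimp.
Qed.

Lemma tens_hmodule U V : hmodule U -> hmodule V -> hmodule (yd_tens U V).
Proof.
move=> hU hV; split.
- split=> [h|t] a x y; rewrite !tens_act //.
    by have [lT _] := tact_bilin (hmodule_bilin hU) (hmodule_bilin hV); apply: lT.
  have [_ lT] := tact_bilin (hmodule_bilin hU) (hmodule_bilin hV).
  by rewrite linearP; apply: lT.
- move=> t; rewrite tens_act // rmorph1 tensor1.
  by pure t => u v; tsimp; rewrite !hmodule1.
move=> g h t; rewrite !tens_act // rmorphM tactM //; try by lin.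
  exact: hmoduleM.
exact: hmoduleM.
Qed.

Lemma tmap_hlinear U U' V V' (f : U -> U') (g : V -> V') :
  hmodule U -> hmodule V -> hmodule U' -> hmodule V' ->
  hlinear U U' f -> hlinear V V' g ->
  hlinear (yd_tens U V) (yd_tens U' V') (tmap f g).
Proof.
move=> hU hV hU' hV' hf hg; split=> [|h t]; first by lin.
rewrite !tens_act //; pure t => u v; tsimp.
by pure (Δ h) => a b; tsimp; rewrite !hlinearE.
Qed.

End TensorModules.

#[global] Hint Extern 1 (hmodule (yd_tens _ _)) => apply: tens_hmodule; lin : lin.
#[global] Hint Extern 1 (hlinear _ _ id) => exact: id_hlinear : lin.
#[global] Hint Extern 1 (hlinear _ _ (tmap _ _)) => apply: tmap_hlinear; lin : lin.

Section Associator.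
Variables (k : fieldType) (H : quasiHopf k).
Implicit Types U V W L : ydData H.

Local Notation Δ := (Delta H).
Local Notation Φ := (Phi H).
Local Notation Φ' := (PhiV H).
Local Notation act := (@yd_act k H _).
Local Notation act3 := (tact act (tact act act)).

(** Separates the associator into plain rebracketing and the action of the single element Φ, so that
    computations take place in the algebra [H ⊗ H ⊗ H]. *)
Lemma yd_assocE U V W (t : yd_tens (yd_tens U V) W) :
  hmodule U -> hmodule V -> hmodule W -> yd_assoc t = act3 Φ (tassoc t).
Proof.
move=> hU hV hW; rewrite /yd_assoc; pure t => s w; pure s => u v; tsimp.
by pure (Phi H) => a T; pure T => b c; tsimp.
Qed.

Definition yd_assocV U V W (t : yd_tens U (yd_tens V W)) : (U ⊗ V) ⊗ W :=
  tassocV (act3 Φ' t).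

Lemma act3M U V W : hmodule U -> hmodule V -> hmodule W ->
  forall S T (t : U ⊗ V ⊗ W), act3 (S * T) t = act3 S (act3 T t).
Proof.
move=> hU hV hW; apply: tactM; try by lin.
  exact: hmoduleM.
by apply: tactM; try (by lin); apply: hmoduleM.
Qed.

Lemma act3_1 U V W : hmodule U -> hmodule V -> hmodule W ->
  forall t : U ⊗ V ⊗ W, act3 1 t = t.
Proof.
move=> hU hV hW t; rewrite !tensor1.
by pure t => u s; pure s => v w; tsimp; rewrite !hmodule1.
Qed.

Lemma yd_assocK U V W : hmodule U -> hmodule V -> hmodule W ->
  cancel (@yd_assoc k H U V W) (@yd_assocV U V W).
Proof.
move=> hU hV hW t.
by rewrite /yd_assocV yd_assocE // -act3M // PhiVK act3_1 // tassocK.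
Qed.

Lemma yd_assocVK U V W : hmodule U -> hmodule V -> hmodule W ->
  cancel (@yd_assocV U V W) (@yd_assoc k H U V W).
Proof.
move=> hU hV hW t.
by rewrite yd_assocE // /yd_assocV tassocVK -act3M // PhiK act3_1.
Qed.

(** On the two bracketings [h] acts through (Δ ⊗ id)Δ(h) and (id ⊗ Δ)Δ(h), which Φ intertwines by
    quasi-coassociativity. *)
Lemma yd_assoc_hlinear U V W : hmodule U -> hmodule V -> hmodule W ->
  hlinear (yd_tens (yd_tens U V) W) (yd_tens U (yd_tens V W)) (@yd_assoc k H U V W).
Proof.
move=> hU hV hW; split=> [|h t].
  suff -> : @yd_assoc k H U V W = fun t => act3 Φ (tassoc t) by lin.
  by apply: funext => t; apply: yd_assocE.
rewrite !yd_assocE //.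
have -> : tassoc (h ▷ t) = act3 (tassoc (tmap Δ id (Δ h))) (tassoc t).
  rewrite tens_act; try by lin.
  pure t => s w; pure (Δ h) => a b; tsimp; rewrite tens_act //.
  by pure s => u v; pure (Δ a) => c d; tsimp.
have -> : h ▷ (act3 Φ (tassoc t) : yd_tens U (yd_tens V W))
    = act3 (tmap id Δ (Δ h)) (act3 Φ (tassoc t)).
  rewrite tens_act; try by lin.
  pure (tassoc t) => u s; pure s => v w; pure (Phi H) => a T; pure T => b c.
  by tsimp; pure (Δ h) => d e; tsimp; rewrite tens_act //.
by rewrite -!act3M // Delta_coassoc -!mulrA PhiVK mulr1.
Qed.

Lemma yd_assocV_hlinear U V W : hmodule U -> hmodule V -> hmodule W ->
  hlinear (yd_tens U (yd_tens V W)) (yd_tens (yd_tens U V) W) (@yd_assocV U V W).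
Proof.
move=> hU hV hW; split=> [|h t].
  by rewrite /yd_assocV; lin.
apply: (can_inj (yd_assocK hU hV hW)).
by rewrite (hlinearE (yd_assoc_hlinear hU hV hW)) !yd_assocVK //; lin.
Qed.

Lemma yd_assoc_tensor U V W (u : U) (v : V) (w : W) :
  hmodule U -> hmodule V -> hmodule W ->
  yd_assoc ((u ⊗ v) ⊗ w) = act3 Φ (u ⊗ v ⊗ w).
Proof. by move=> *; rewrite yd_assocE // tassoc_tensor. Qed.

End Associator.

#[global] Hint Extern 1 (hlinear _ _ (@yd_assoc _ _ _ _ _)) =>
  apply: yd_assoc_hlinear; lin : lin.
#[global] Hint Extern 1 (hlinear _ _ (@yd_assocV _ _ _ _ _)) =>
  apply: yd_assocV_hlinear; lin : lin.
#[global] Hint Extern 1 (GRing.linear_for _ (@yd_assoc _ _ _ _ _)) =>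
  apply: (hlinear_lin (yd_assoc_hlinear _ _ _)); lin : lin.
#[global] Hint Extern 1 (GRing.linear_for _ (@yd_assocV _ _ _ _ _)) =>
  apply: (hlinear_lin (yd_assocV_hlinear _ _ _)); lin : lin.

(** * Naturality of the associator and the pentagon *)

Section Coherence.
Variables (k : fieldType) (H : quasiHopf k).
Implicit Types U V W L : ydData H.

Local Notation Δ := (Delta H).
Local Notation act := (@yd_act k H _).
Local Notation act3 := (tact act (tact act act)).
Local Notation act4 := (tact act act3).

Lemma yd_assoc_nat U V W U' V' W' (f : U -> U') (g : V -> V') (h : W -> W') t :
  hmodule U -> hmodule V -> hmodule W ->
  hmodule U' -> hmodule V' -> hmodule W' ->
  hlinear U U' f -> hlinear V V' g -> hlinear W W' h ->
  yd_assoc (tmap (tmap f g) h t) = tmap f (tmap g h) (yd_assoc t).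
Proof.
move=> hU hV hW hU' hV' hW' hf hg hh.
pure t => s w; pure s => u v; tsimp; rewrite !yd_assoc_tensor //.
by pure (Phi H) => a T; pure T => b c; tsimp; rewrite !hlinearE.
Qed.

Lemma yd_assocV_nat U V W U' V' W' (f : U -> U') (g : V -> V') (h : W -> W') t :
  hmodule U -> hmodule V -> hmodule W ->
  hmodule U' -> hmodule V' -> hmodule W' ->
  hlinear U U' f -> hlinear V V' g -> hlinear W W' h ->
  yd_assocV (tmap f (tmap g h) t) = tmap (tmap f g) h (yd_assocV t).
Proof.
move=> hU hV hW hU' hV' hW' hf hg hh.
apply: (can_inj (yd_assocK hU' hV' hW')).
by rewrite yd_assoc_nat // !yd_assocVK.
Qed.

Lemma yd_pentagon U V W L (t : (((U ⊗ V) ⊗ W) ⊗ L)%type) :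
  hmodule U -> hmodule V -> hmodule W -> hmodule L ->
  tmap id (@yd_assoc k H V W L)
    (@yd_assoc k H U (yd_tens V W) L (tmap (@yd_assoc k H U V W) id t))
  = @yd_assoc k H U V (yd_tens W L) (@yd_assoc k H (yd_tens U V) W L t).
Proof.
move=> hU hV hW hX.
have act4M : forall S T (s : (U ⊗ V ⊗ W ⊗ L)%type), act4 (S * T) s = act4 S (act4 T s).
  apply: tactM; try by lin.
    exact: hmoduleM.
  exact: act3M.
pure t => s x; pure s => r w; pure r => u v; tsimp.
set y := u ⊗ v ⊗ w ⊗ x.
(* The two composites of associators are the actions on [y] of the two sides of the pentagon
   equation for Φ. *)
transitivity (act4 ((1 ⊗ Phi H)
    * (\tsum_(X1, X2, X3 <- Phi H) \tsum_(a, b <- Δ X2) X1 ⊗ a ⊗ b ⊗ X3)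
    * (\tsum_(X1, X2, X3 <- Phi H) X1 ⊗ X2 ⊗ X3 ⊗ 1)) y).
  rewrite !act4M yd_assoc_tensor //.
  have -> : act4 (\tsum_(X1, X2, X3 <- Phi H) X1 ⊗ X2 ⊗ X3 ⊗ 1) y
      = tmap id (@tassoc k V W L) (tassoc (act3 (Phi H) (u ⊗ v ⊗ w) ⊗ x)).
    by pure (Phi H) => a T; pure T => b c; rewrite /y; tsimp; rewrite hmodule1.
  (* The result of the first copy of Φ is replaced by an arbitrary pure tensor, so that the next
     copy can be expanded independently of it. *)
  move: (act3 _ _) => p; pure p => u' q; pure q => v' w'; tsimp.
  have -> : act4 (\tsum_(X1, X2, X3 <- Phi H) \tsum_(a, b <- Δ X2)
      X1 ⊗ a ⊗ b ⊗ X3) (u' ⊗ v' ⊗ w' ⊗ x) = tmap id (@tassoc k V W L)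
        (@yd_assoc k H U (yd_tens V W) L ((u' ⊗ (v' ⊗ w')) ⊗ x)).
    rewrite yd_assoc_tensor; try by lin.
    pure (Phi H) => a T; pure T => b c; tsimp; rewrite tens_act //.
    by pure (Δ b) => d e; tsimp.
  move: (yd_assoc _) => p'; pure p' => u2 r'; pure r' => s' x2.
  pure s' => v2 w2; tsimp.
  by rewrite hmodule1 // yd_assoc_tensor.
rewrite Phi_pentagon act4M.
have -> : act4 (\tsum_(X1, X2, X3 <- Phi H) \tsum_(a, b <- Δ X1)
    a ⊗ b ⊗ X2 ⊗ X3) y
    = tassoc (@yd_assoc k H (yd_tens U V) W L (((u ⊗ v) ⊗ w) ⊗ x)).
  rewrite yd_assoc_tensor; try by lin.
  pure (Phi H) => a T; pure T => b c; rewrite /y; tsimp; rewrite tens_act //.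
  by pure (Δ a) => d e; tsimp.
move: (yd_assoc _) => p; pure p => s' t'; pure s' => u' v'; tsimp.
rewrite yd_assoc_tensor; try by lin.
pure (Phi H) => a T; pure T => b c; tsimp; rewrite tens_act //.
Qed.

End Coherence.

(** * Braiding and Galois map *)

Section YDModules.
Variables (k : fieldType) (H : quasiHopf k).
Implicit Types U V W L : ydData H.

Lemma yd_hmodule U : is_yd U -> hmodule U.
Proof. by case=> [b1 b2 b3 _ _ _ _]; split. Qed.

Lemma yd_mor_hlinear U V (f : U -> V) : is_yd_mor U V f -> hlinear U V f.
Proof. by case=> f_lin fE _; split. Qed.

End YDModules.

#[global] Hint Extern 2 (hmodule _) => apply: yd_hmodule; lin : lin.
#[global] Hint Extern 1 (GRing.linear_for _ (@yd_coact _ _ _)) =>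
  apply: yd_coact_linear; lin : lin.

Section Braiding.
Variables (k : fieldType) (H : quasiHopf k).
Implicit Types U V W L : ydData H.

Local Notation Δ := (Delta H).
Local Notation act := (@yd_act k H _).

Definition yd_braid U V (t : yd_tens U V) : V ⊗ U :=
  \tsum_(u, v <- t) \tsum_(a, u0 <- λ u) (a ▷ v) ⊗ u0.

Lemma yd_braid_hlinear U V : is_yd U -> hmodule V ->
  hlinear (yd_tens U V) (yd_tens V U) (@yd_braid U V).
Proof.
move=> yU hV; have hU := yd_hmodule yU.
have braid_lin : linear (@yd_braid U V) by rewrite /yd_braid; lin.
split=> // h t; pure t => u v.
have -> : @yd_braid U V (u ⊗ v) = \tsum_(a, u0 <- λ u) (a ▷ v) ⊗ u0.
  by rewrite /yd_braid; tsimp.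
(* [g] maps the two sides of the compatibility axiom [yd_compat] to the two sides of the goal. *)
pose g a u0 : V ⊗ U := (a ▷ v) ⊗ u0.
have g_bilin : bilin g by rewrite /g; lin.
transitivity (tsum g (\tsum_(h1, h2 <- Δ h) \tsum_(a, u0 <- λ (h1 ▷ u))
    (a * h2) ⊗ u0)).
  rewrite tens_act //; pure (Δ h) => a b; tsimp.
  rewrite /yd_braid; tsimp; pure (λ (a ▷ u)) => c u0; tsimp.
  by rewrite /g hmoduleM.
rewrite -yd_compat //; pure (λ u) => a u0; tsimp; rewrite tens_act //.
by pure (Δ h) => c d; tsimp; rewrite /g hmoduleM.
Qed.

End Braiding.

#[global] Hint Extern 1 (hlinear _ _ (@yd_braid _ _ _ _)) =>
  apply: yd_braid_hlinear; lin : lin.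
#[global] Hint Extern 1 (GRing.linear_for _ (@yd_braid _ _ _ _)) =>
  apply: (hlinear_lin (yd_braid_hlinear _ _)); lin : lin.

(** * The action of [B ⊗ B] on [M ⊗ B] as a composite of associators and one braiding *)

Section BraidedAction.
Variables (k : fieldType) (H : quasiHopf k) (B : hopfData H) (M : ydData H).

Local Notation Δ := (Delta H).
Local Notation act := (@yd_act k H _).
Local Notation act3 := (tact act (tact act act)).

(* B ⊗ (B ⊗ B) ≅ (B ⊗ B) ⊗ B → (B ⊗ B) ⊗ B ≅ B ⊗ (B ⊗ B), braiding the first two
   factors *)
Definition braid_left : B ⊗ B ⊗ B -> B ⊗ B ⊗ B := fun t =>
  @yd_assoc k H B B B (tmap (@yd_braid k H B B) id (@yd_assocV k H B B B t)).

Hypotheses (yB : is_yd B) (hM : hmodule M).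
Let hB : hmodule B := yd_hmodule yB.

Lemma braid_left_hlinear :
  hlinear (yd_tens B (yd_tens B B)) (yd_tens B (yd_tens B B)) braid_left.
Proof.
have braid_h := tmap_hlinear (tens_hmodule hB hB) hB (tens_hmodule hB hB) hB
  (yd_braid_hlinear yB hB) (id_hlinear B).
exact: (hlinear_comp (yd_assoc_hlinear hB hB hB)
  (hlinear_comp braid_h (yd_assocV_hlinear hB hB hB))).
Qed.

(** Replaces the formula in components by a composite of maps, to which naturality and the pentagon
    apply. *)
Lemma braided_actE (r : M ⊗ B -> M) s t : linear r -> linear (@hd_mul k H B) ->
  braided_act r s t = tmap r (@hd_mul k H B)
    (@yd_assocV k H M B (yd_tens B B) (tmap id braid_left
      (@yd_assoc k H M B (yd_tens B B) (s ⊗ t)))).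
Proof.
have braid_lin := hlinear_lin braid_left_hlinear.
move=> r_lin mul_lin; rewrite /braided_act.
pure s => m b; pure t => c d; tsimp.
rewrite yd_assoc_tensor; try by lin.
rewrite /yd_assocV.
have -> : braid_left = fun t => act3 (Phi H) (tassoc (tmap (@yd_braid k H B B)
    id (tassocV (act3 (PhiV H) t)))).
  by apply: funext => z; rewrite /braid_left yd_assocE.
(* The two copies of Φ, and those of its inverse, have to vary independently. *)
move: {2 4}(Phi H) {2 4}(PhiV H) => F1 G1; move: (Phi H) (PhiV H) => F2 G2.
pure F1 => X1 T1; pure T1 => X2 X3; tsimp.
pure G1 => x1 T2; pure T2 => x2 x3; tsimp.
pure G2 => y1 T3; pure T3 => y2 y3; tsimp.
pure F2 => Y1 T4; pure T4 => Y2 Y3; tsimp.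
rewrite tens_act //; pure (Δ X3) => X31 X32; tsimp.
rewrite /yd_braid; tsimp; rewrite (hmoduleM hB x1 X2 b).
pure (λ (x1 ▷ X2 ▷ b)) => a b0; tsimp; rewrite tens_act //.
by pure (Δ y3) => y31 y32; tsimp; rewrite !hmoduleM.
Qed.

End BraidedAction.

Section HopfModuleTheory.
Variables (k : fieldType) (H : quasiHopf k) (B : hopfYD H).

Lemma hopf_yd_car : is_yd B. Proof. exact: hopf_yd (hopf_ax B). Qed.
Let yB : is_yd B := hopf_yd_car.
Let hB : hmodule B := yd_hmodule yB.

Local Notation μ := (@hd_mul k H B).
Local Notation comul := (@hd_comul k H B).
Local Notation S := (@hd_antip k H B).
Local Notation ψ := (@braid_left k H B).

Lemma hd_mul_hlinear : hlinear (yd_tens B B) B μ.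
Proof. exact/yd_mor_hlinear/(hopf_mul_mor (hopf_ax B)). Qed.
Let μ_h := hd_mul_hlinear.

Lemma hd_comul_hlinear : hlinear B (yd_tens B B) comul.
Proof. exact/yd_mor_hlinear/(hopf_comul_mor (hopf_ax B)). Qed.
Let comul_h := hd_comul_hlinear.

Lemma hd_antip_hlinear : hlinear B B S.
Proof. exact/yd_mor_hlinear/(hopf_antip_mor (hopf_ax B)). Qed.
Let S_h := hd_antip_hlinear.

Let μ_lin := hlinear_lin μ_h.
Let comul_lin := hlinear_lin comul_h.
Let S_lin := hlinear_lin S_h.
Let ψ_h := braid_left_hlinear yB.
Let ψ_lin := hlinear_lin ψ_h.

Lemma hd_comul_mul t : comul (μ t) = tmap μ μ
  (@yd_assocV k H B B (yd_tens B B) (tmap id ψ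
    (@yd_assoc k H B B (yd_tens B B) (tmap comul comul t)))).
Proof.
pure t => b c; tsimp.
by rewrite (hopf_comulM (hopf_ax B)) (braided_actE yB hB).
Qed.

Section Module.
Variable M : hmodData B.
Hypotheses (yM : is_yd M) (r_h : hlinear (yd_tens M B) M (@hm_act k H B M)).
Hypothesis rA : forall (m : M) (b c : B),
  (m ↼ b) ↼ c = \tsum_(X1, X2, X3 <- Phi H) (X1 ▷ m) ↼ ((X2 ▷ b) ∙ (X3 ▷ c)).
Let hM : hmodule M := yd_hmodule yM.

Local Notation r := (@hm_act k H B M).
Let r_lin := hlinear_lin r_h.

Lemma hm_act_assoc t : r (tmap r id t) = r (tmap id μ (@yd_assoc k H M B B t)).
Proof.
pure t => s c; pure s => m b; tsimp; rewrite rA yd_assoc_tensor //.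
by pure (Phi H) => X1 T; pure T => X2 X3; tsimp.
Qed.

(* m ⊗ b ↦ Σ ((x1 ▷ m) ↼ (x2 ▷ b1)) ⊗ (x3 ▷ b2), see [galois_tensorE] *)
Definition galois (t : M ⊗ B) : M ⊗ B :=
  tmap r id (@yd_assocV k H M B B (tmap id comul t)).

Lemma galois_lin : linear galois.
Proof. by rewrite /galois; lin. Qed.

(** Both sides are images of one element [z'], in which the crossing is done and nothing is
    multiplied yet. On the left [M] is acted on twice, on the right once by a product; these agree
    by associativity of the action. *)
Lemma braided_act_galois t c : braided_act r (galois t) (comul c) =
  galois (tmap id μ (@yd_assoc k H M B B (t ⊗ c))).
Proof.
have g_lin := galois_lin.
rewrite braided_actE //.
(* [y] carries the five strands before the crossing, [z] and [z'] after it; [z'] is [z] with the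
   bracketing of [y]. *)
pose y := tmap (@yd_assocV k H M B B) id
  (tmap (tmap id comul) comul (t ⊗ c)).
pose z := tmap id ψ (@yd_assoc k H (yd_tens M B) B (yd_tens B B) y).
pose z' := @yd_assocV k H (yd_tens M B) B (yd_tens B B) z.
transitivity (tmap (fun s => r (tmap r id s)) μ z').
  have -> : galois t ⊗ comul c = tmap (tmap r id) id y.
    by rewrite /y; tsimp.
  rewrite (@yd_assoc_nat _ _ (yd_tens M B) B (yd_tens B B) M B (yd_tens B B)
    r id id); try by lin.
  rewrite tmap_id tmap_merger; try by lin.
  have -> : tmap r ψ (@yd_assoc k H (yd_tens M B) B (yd_tens B B) y)
      = tmap r (tmap id id) z.
    by rewrite /z tmap_id tmap_mergel; try by lin.
  rewrite (@yd_assocV_nat _ _ (yd_tens M B) B (yd_tens B B) M B (yd_tens B B)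
    r id id); try by lin.
  rewrite -/z' tmap_comp; try by lin.
  by [].
rewrite /galois tmap_idl //; try by lin.
rewrite (_ : (fun v => _) = fun v => tmap μ μ
    (@yd_assocV k H B B (yd_tens B B) (tmap id ψ
      (@yd_assoc k H B B (yd_tens B B) (tmap comul comul v))))); last first.
  exact/funext/hd_comul_mul.
(* This and the next two facts move [y], [z] and [z'] to the bracketings with [M] split off, where
   the right-hand side is computed. The last two rest on the pentagon. *)
have y_assoc : @yd_assoc k H M (yd_tens B B) (yd_tens B B)
      (tmap (@yd_assoc k H M B B) id y)
    = tmap id (tmap comul comul) (@yd_assoc k H M B B (t ⊗ c)).
  rewrite -(@yd_assoc_nat _ _ M B B M (yd_tens B B) (yd_tens B B)); try by lin.
  rewrite /y tmap_idr; try by lin.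
  congr yd_assoc.
  by apply: tmap_eq_id => // w; rewrite yd_assocVK.
have z_assoc : tmap id (fun v => tmap id ψ (@yd_assoc k H B B (yd_tens B B)
      (tmap comul comul v))) (@yd_assoc k H M B B (t ⊗ c))
    = @yd_assoc k H M B (yd_tens B (yd_tens B B)) z.
  pose assocB := @yd_assoc k H B B (yd_tens B B).
  rewrite -(tmap_idl (g' := fun v => tmap id ψ (assocB v))
    (g := tmap comul comul)) /assocB; try by lin.
  rewrite -y_assoc -(tmap_idl (g' := tmap id ψ)); try by lin.
  rewrite yd_pentagon; try by lin.
  rewrite /z -(@yd_assoc_nat _ _ M B (yd_tens B (yd_tens B B)) M B
    (yd_tens B (yd_tens B B)) id id ψ); try by lin.
  by rewrite tmap_id.
have z'_assoc : tmap id (fun v => @yd_assocV k H B B (yd_tens B B)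
      (tmap id ψ (@yd_assoc k H B B (yd_tens B B)
      (tmap comul comul v)))) (@yd_assoc k H M B B (t ⊗ c))
    = @yd_assoc k H M (yd_tens B B) (yd_tens B B)
      (tmap (@yd_assoc k H M B B) id z').
  rewrite -(tmap_idl (g' := @yd_assocV k H B B (yd_tens B B))
    (g := fun v => tmap id ψ (@yd_assoc k H B B (yd_tens B B)
      (tmap comul comul v)))); try by lin.
  rewrite z_assoc.
  have -> : z = @yd_assoc k H (yd_tens M B) B (yd_tens B B) z'.
    by rewrite yd_assocVK; try by lin.
  rewrite -yd_pentagon; try by lin.
  rewrite tmap_idl; try by lin.
  by apply: tmap_eq_id => // w; rewrite yd_assocK; try by lin.
rewrite -(tmap_idl (g' := tmap μ μ)
  (g := fun v => @yd_assocV k H B B (yd_tens B B) (tmap id ψ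
    (@yd_assoc k H B B (yd_tens B B) (tmap comul comul v))))); try by lin.
rewrite z'_assoc.
rewrite -(@yd_assoc_nat _ _ M (yd_tens B B) (yd_tens B B) M B B id); try by lin.
rewrite yd_assocK //.
rewrite !tmap_comp; try by lin.
by apply: eq_tmap => // w; rewrite hm_act_assoc.
Qed.

End Module.
End HopfModuleTheory.

(** * The projection onto the coinvariants *)

Section YDMorphisms.
Variables (k : fieldType) (H : quasiHopf k).
Implicit Types U V W : ydData H.

Lemma id_yd_mor U : is_yd_mor U U id.
Proof. by split=> // u; rewrite tmap_id. Qed.

Lemma yd_mor_comp U V W (g : V -> W) (f : U -> V) :
  is_yd_mor V W g -> is_yd_mor U V f -> is_yd_mor U W (fun u => g (f u)).
Proof.
move=> [g_lin gE gco] [f_lin fE fco]; split=> [|h u|u].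
- by lin.
- by rewrite fE gE.
by rewrite gco fco tmap_idl.
Qed.

Lemma tmap_yd_mor U U' V V' (f : U -> U') (g : V -> V') :
  is_yd U -> is_yd V -> is_yd U' -> is_yd V' ->
  is_yd_mor U U' f -> is_yd_mor V V' g ->
  is_yd_mor (yd_tens U V) (yd_tens U' V') (tmap f g).
Proof.
move=> yU yV yU' yV' mf mg.
have [hf hg] := (yd_mor_hlinear mf, yd_mor_hlinear mg).
have fg_h : hlinear (yd_tens U V) (yd_tens U' V') (tmap f g) by lin.
split=> [||t]; [by lin | exact: hlinearE |].
have fg_lin : linear (tmap id (tmap f g) : (H ⊗ U ⊗ V)%type -> (H ⊗ U' ⊗ V')%type).
  by lin.
rewrite /=; pure t => u v; tsimp.
(* Six sums for the legs of Φ, Φ^{-1} and Φ; the two coactions follow, where [f] and [g] enter. *)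
do 6![rewrite (lin_tsum_comm _ _ fg_lin); apply: eq_tsum => ? ?].
rewrite -(hlinearE hf) (yd_mor_coact mf) tsum_tmap; try by lin.
rewrite (lin_tsum_comm _ _ fg_lin); apply: eq_tsum => ? ?.
rewrite -(hlinearE hg) (yd_mor_coact mg) tsum_tmap; try by lin.
rewrite (lin_tsum_comm _ _ fg_lin); apply: eq_tsum => ? ?.
by tsimp; rewrite (hlinearE hf) (hlinearE hg).
Qed.

End YDMorphisms.

Section Counit.
Variables (k : fieldType) (H : quasiHopf k).

(** The form in which (id ⊗ ε ⊗ id)(Φ) = 1 is applied: when the middle leg of Φ acts only through ε,
    the reassociation is trivial. *)
Lemma Phi_counit_sum (W : lmodType k) (g : H -> k^o -> H -> W) :
  (forall a, bilin (g a)) -> (forall b c, linear (fun a => g a b c)) ->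
  \tsum_(X1, X2, X3 <- Phi H) g X1 (eps H X2) X3 = g 1 1 1.
Proof.
move=> g_bilin g_lin.
transitivity (\tsum_(a, b, c <- tmap id (tmap (eps H) id) (Phi H)) g a b c).
  by pure (Phi H) => a T; pure T => b c; tsimp.
by rewrite Phi_counit; tsimp.
Qed.

End Counit.

Section Projection.
Variables (k : fieldType) (H : quasiHopf k) (B : hopfYD H) (M : hmodData B).
Hypothesis modM : is_hmod M.

Local Notation μ := (@hd_mul k H B).
Local Notation comul := (@hd_comul k H B).
Local Notation counit := (@hd_counit k H B).
Local Notation S := (@hd_antip k H B).
Local Notation one := (hd_one B).
Local Notation r := (@hm_act k H B M).
Local Notation P := (@hm_proj k H B M).

Let yB : is_yd B := hopf_yd_car B.
Let yM : is_yd M := hm_is_yd modM.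
Let hB := yd_hmodule yB.
Let hM := yd_hmodule yM.
Let μ_h := hd_mul_hlinear B.
Let comul_h := hd_comul_hlinear B.
Let S_h := hd_antip_hlinear B.
Let μ_lin := hlinear_lin μ_h.
Let comul_lin := hlinear_lin comul_h.
Let S_lin := hlinear_lin S_h.
Let r_h := yd_mor_hlinear (hm_act_mor modM).
Let r_lin := hlinear_lin r_h.
Let ρ_h := yd_mor_hlinear (hm_coact_mor modM).
Let ρ_lin := hlinear_lin ρ_h.
Let counit_lin : linear (counit : B -> k^o) := yd_mor_linear (hopf_counit_mor (hopf_ax B)).

Lemma act_hd_one h : h ▷ one = (eps H h : k) *: one.
Proof.
have [u_lin uE _] := hopf_unit_mor (hopf_ax B).
have /= <- := uE h 1; rewrite mulr1.
by have := linearZ_of u_lin (eps H h) 1; rewrite -[_ *: _]/(_ * _) mulr1.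
Qed.

(** [H] acts on the unit in the middle through ε, so Φ disappears. *)
Lemma tmap_mul_assoc1 (m : M) (b : B) :
  tmap id μ (@yd_assoc k H M B B ((m ⊗ one) ⊗ b)) = m ⊗ b.
Proof.
pose g (a : H) (x : k^o) c : (M ⊗ B)%type := (a ▷ m) ⊗ (((x : k) *: one) ∙ (c ▷ b)).
transitivity (\tsum_(X1, X2, X3 <- Phi H) g X1 (eps H X2) X3).
  rewrite yd_assoc_tensor // /g.
  pure (Phi H) => X1 T; pure T => X2 X3; tsimp.
  by rewrite act_hd_one.
rewrite Phi_counit_sum /g; try by lin.
by rewrite scale1r !hmodule1 // (hopf_mul1l (hopf_ax B)).
Qed.

Lemma galois1 (m : M) : galois (m ⊗ one) = m ⊗ one.
Proof.
rewrite /galois; tsimp; rewrite (hopf_comul1 (hopf_ax B)).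
suff <- : @yd_assoc k H M B B ((m ⊗ one) ⊗ one) = m ⊗ one ⊗ one.
  by rewrite yd_assocK //; tsimp; rewrite (hm_act1 modM).
pose g (a : H) (x : k^o) c : (M ⊗ B ⊗ B)%type :=
  (a ▷ m) ⊗ ((x : k) *: one) ⊗ (c ▷ one).
transitivity (\tsum_(X1, X2, X3 <- Phi H) g X1 (eps H X2) X3).
  rewrite yd_assoc_tensor // /g.
  pure (Phi H) => X1 T; pure T => X2 X3; tsimp.
  by rewrite act_hd_one.
rewrite Phi_counit_sum /g; try by lin.
by rewrite scale1r !hmodule1.
Qed.

Lemma hm_projE m : P m = r (tmap id S (ρ m)).
Proof. by rewrite /hm_proj /tmap lin_tsum_comm. Qed.

Lemma hm_proj_yd_mor : is_yd_mor M M P.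
Proof.
have -> : P = fun m => r (tmap id S (ρ m)) by apply/funext/hm_projE.
apply: yd_mor_comp (hm_act_mor modM) _.
apply: yd_mor_comp _ (hm_coact_mor modM).
apply: tmap_yd_mor => //; first exact: id_yd_mor.
exact: hopf_antip_mor (hopf_ax B).
Qed.

Let P_h := yd_mor_hlinear hm_proj_yd_mor.
Let P_lin := hlinear_lin P_h.

Lemma mul_antip_comul b : μ (tmap S id (comul b)) = counit b *: one.
Proof. by rewrite -(hopf_antipl (hopf_ax B)) /tmap lin_tsum_comm. Qed.

Lemma mul_comul_antip b : μ (tmap id S (comul b)) = counit b *: one.
Proof. by rewrite -(hopf_antipr (hopf_ax B)) /tmap lin_tsum_comm. Qed.

Let ρA m : @yd_assoc k H M B B (tmap (@hm_coact k H B M) id (ρ m))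
  = tmap id comul (ρ m).
Proof. exact: (hm_coassoc modM). Qed.

(** Associativity of the action and coassociativity of the coaction bring S(b1) b2 together, which
    the antipode axiom collapses to the counit. *)
Lemma hm_act_projK m : r (tmap P id (ρ m)) = m.
Proof.
have -> : tmap P id (ρ m) =
    tmap r id (tmap (tmap id S) id (tmap (@hm_coact k H B M) id (ρ m))).
  rewrite !tmap_idr; try by lin.
  by apply: eq_tmap => // m'; rewrite hm_projE.
rewrite (hm_act_assoc yM r_h (hm_actA modM)) // yd_assoc_nat; try by lin.
rewrite ρA !tmap_idl; try by lin.
transitivity (\tsum_(m0, m1 <- ρ m) counit m1 *: m0); last exact: (hm_counit modM).
have -> : (fun b => μ (tmap S id (comul b))) = fun b => counit b *: one.
  exact/funext/mul_antip_comul.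
rewrite lin_tsum_comm //; apply: eq_tsum => m0 m1.
have r_lin' : linear (fun b => r (m0 ⊗ b)) by lin.
by rewrite (linearZ_of r_lin') (hm_act1 modM).
Qed.

(** Coassociativity cancels the inverse associator inside [galois], leaving [hm_act_projK] on the
    first factor. *)
Lemma galois_proj m : galois (tmap P id (ρ m)) = ρ m.
Proof.
rewrite /galois tmap_merger; try by lin.
have -> : tmap P comul (ρ m) = tmap P (tmap id id) (tmap id comul (ρ m)).
  by rewrite tmap_id tmap_mergel.
rewrite (@yd_assocV_nat _ _ M B B M B B P id id); try by lin.
rewrite -ρA yd_assocK // !tmap_idr; try by lin.
by apply: tmap_eq_id => // m'; rewrite hm_act_projK.
Qed.

Lemma hm_proj_coinv m : P m \in coinv M.
Proof.
apply/coinvP; rewrite -galois1.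
have g_lin := galois_lin yM r_h.
(* Every ρ(n) is a value of [galois], by [galois_proj], so the key identity computes ρ(n ↼ b) for an
   arbitrary [n]. *)
have coact_act t : ρ (r t) =
    galois (tmap id μ (@yd_assoc k H M B B
      (tmap (fun m => tmap P id (ρ m)) id t))).
  pure t => n b; tsimp.
  by rewrite (hm_compat modM) -(braided_act_galois yM r_h (hm_actA modM)) galois_proj.
rewrite {1}hm_projE coact_act; congr galois.
rewrite tmap_mergel; try by lin.
have -> : tmap (fun m => tmap P id (ρ m)) S (ρ m) =
    tmap (tmap P id) S (tmap (@hm_coact k H B M) id (ρ m)).
  by rewrite tmap_rl; try by lin.
rewrite yd_assoc_nat; try by lin.
rewrite ρA.
transitivity (tmap P (fun b => μ (tmap id S (comul b))) (ρ m)).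
  by rewrite !tmap_comp; try by lin.
have -> : (fun b => μ (tmap id S (comul b))) = fun b => counit b *: one.
  exact/funext/mul_comul_antip.
(* Expanding [m] on the right by the counit axiom makes both sides sums over ρ(m). *)
rewrite -{2}(hm_counit modM m) (lin_tsum_comm _ _ P_lin).
rewrite (lin_tsum_comm (g := fun m => m ⊗ one)); last by lin.
apply: eq_tsum => m0 m1.
by rewrite (linearZ_of P_lin) tensorZl tensorZr.
Qed.

(** Here ρ(n) = n ⊗ 1 is itself [galois (n ⊗ one)], so the key identity applies and the product with
    the unit is absorbed. *)
Lemma hm_coact_coinv_act n b : n \in coinv M -> ρ (n ↼ b) = galois (n ⊗ b).
Proof.
move/coinvP=> nE; rewrite (hm_compat modM) nE -{1}galois1.
by rewrite (braided_act_galois yM r_h (hm_actA modM)) tmap_mul_assoc1.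
Qed.

Lemma galois_tensorE (n : M) b : galois (n ⊗ b) =
  \tsum_(x1, x2, x3 <- PhiV H) \tsum_(b1, b2 <- comul b)
    ((x1 ▷ n) ↼ (x2 ▷ b1)) ⊗ (x3 ▷ b2).
Proof.
rewrite /galois /yd_assocV; tsimp; pure (comul b) => b1 b2.
by pure (PhiV H) => x1 T; pure T => x2 x3; tsimp.
Qed.

(** The inverse associator in ρ(n ↼ b) cancels the associator from associativity of the action,
    which leaves n ↼ (b1 S(b2)). *)
Lemma hm_proj_coinv_act n b : n \in coinv M -> P (n ↼ b) = counit b *: n.
Proof.
move=> n_coinv; rewrite hm_projE hm_coact_coinv_act //.
rewrite /galois tmap_merger; try by lin.
tsimp; set q := yd_assocV _.
have -> : tmap r S q = tmap r id (tmap (tmap id id) S q).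
  by rewrite tmap_id tmap_mergel; try by lin.
rewrite (hm_act_assoc yM r_h (hm_actA modM)).
rewrite (@yd_assoc_nat _ _ M B B M B B id id S); try by lin.
rewrite yd_assocVK //; tsimp; rewrite mul_comul_antip.
have r_lin' : linear (fun b => r (n ⊗ b)) by lin.
by rewrite (linearZ_of r_lin') (hm_act1 modM).
Qed.

Lemma hm_proj_id n : n \in coinv M -> P n = n.
Proof.
move=> n_coinv; rewrite -{1}(hm_act1 modM n) hm_proj_coinv_act //.
by rewrite (hopf_counit1 (hopf_ax B)) scale1r.
Qed.

End Projection.

(** * Transport of structure *)

Section Retraction.
Variables (k : fieldType) (U V : lmodType k) (f : U -> V) (g : V -> U).
Hypotheses (f_lin : linear f) (g_lin : linear g) (fK : cancel f g).

Lemma tmapK_l (W : lmodType k) :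
  cancel (@tmap k U V W W f id) (@tmap k V U W W g id).
Proof. by move=> t; rewrite tmap_idr ?tmap_eq_id. Qed.

Lemma tmapK_r (W : lmodType k) :
  cancel (@tmap k W W U V id f) (@tmap k W W V U id g).
Proof. by move=> t; rewrite tmap_idl ?tmap_eq_id. Qed.

End Retraction.

Arguments tmapK_l {k U V f g} f_lin g_lin fK W x.
Arguments tmapK_r {k U V f g} f_lin g_lin fK W x.

Section YDTransport.
Variables (k : fieldType) (H : quasiHopf k) (X Y : ydData H).
Variables (f : X -> Y) (g : Y -> X).
Hypotheses (f_mor : is_yd_mor X Y f) (g_lin : linear g) (fK : cancel f g).

Let f_lin := yd_mor_linear f_mor.
Let f_inj := can_inj fK.

(** The linear retraction [g] keeps [f] injective after tensoring with the identity of [H], so the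
    coaction too can be compared in [Y]. *)
Lemma yd_mor_lift (U : ydData H) (h : U -> X) :
  is_yd_mor U Y (fun u => f (h u)) -> is_yd_mor U X h.
Proof.
case=> fh_lin fhE fhco.
have h_lin : linear h by move=> a u v; apply: f_inj; rewrite fh_lin f_lin.
split=> // [a u|u]; first by apply: f_inj; rewrite fhE (yd_mor_act f_mor).
apply: (can_inj (tmapK_r f_lin g_lin fK H)).
by rewrite -(yd_mor_coact f_mor) fhco tmap_idl.
Qed.

(** Each axiom is checked after applying [f], tensored with identities of [H], and becomes the axiom
    of [Y] at [f x]. It serves both for the inclusion of the coinvariants and for the map F. *)
Lemma yd_transport : is_yd Y -> is_yd X.
Proof.
move=> yY; have hY := yd_hmodule yY.
have fE := yd_mor_act f_mor; have fco := yd_mor_coact f_mor.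
have X_bilin : bilin (@yd_act k H X).
  split=> [h|x] a u v; apply: f_inj; rewrite ?(f_lin, fE).
    exact: (proj1 (hmodule_bilin hY)).
  exact: (proj2 (hmodule_bilin hY)).
have co_lin : linear (@yd_coact k H X).
  move=> a u v; apply: (can_inj (tmapK_r f_lin g_lin fK H)).
  have tf_lin : linear (tmap id f : (H ⊗ X)%type -> (H ⊗ Y)%type) by lin.
  by rewrite tf_lin -!fco f_lin (yd_coact_linear yY).
split=> //.
- by move=> x; apply: f_inj; rewrite fE (yd_act1 yY).
- by move=> a b x; apply: f_inj; rewrite !fE (yd_actM yY).
- move=> x.
  apply: (can_inj (tmapK_r (tmap_linear (@lin_id k H) f_lin)
    (tmap_linear (@lin_id k H) g_lin) (tmapK_r f_lin g_lin fK H) H)).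
  have tf_lin : linear (tmap id (tmap id f)
    : (H ⊗ H ⊗ X)%type -> (H ⊗ H ⊗ Y)%type) by lin.
  have := yd_coassoc yY (f x).
  set l := tsum _ _; set l' := tsum _ _ => E.
  transitivity l; [|rewrite E] => {E}; rewrite {}/l {}/l'.
    do 2![rewrite (lin_tsum_comm _ _ tf_lin); apply: eq_tsum => ? ?].
    rewrite fco tsum_tmap; try by lin.
    rewrite (lin_tsum_comm _ _ tf_lin); apply: eq_tsum => a x0.
    rewrite -fE fco tsum_tmap; try by lin.
    by rewrite (lin_tsum_comm _ _ tf_lin); apply: eq_tsum => b y0; tsimp.
  symmetry.
  do 4![rewrite (lin_tsum_comm _ _ tf_lin); apply: eq_tsum => ? ?].
  rewrite -fE fco tsum_tmap; try by lin.
  do 2![rewrite (lin_tsum_comm _ _ tf_lin); apply: eq_tsum => ? ?].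
  by tsimp; rewrite fE.
- move=> x; apply: f_inj; rewrite -[RHS](yd_counit yY) fco tsum_tmap; try by lin.
  by rewrite lin_tsum_comm //; apply: eq_tsum => a x0; rewrite (linearZ_of f_lin).
move=> h x; apply: (can_inj (tmapK_r f_lin g_lin fK H)).
have tf_lin : linear (tmap id f : (H ⊗ X)%type -> (H ⊗ Y)%type) by lin.
have E := yd_compat yY h (f x).
rewrite !(lin_tsum_comm _ _ tf_lin); etransitivity; first etransitivity; [|exact: E|].
  apply: eq_tsum => h1 h2; rewrite (lin_tsum_comm _ _ tf_lin) fco tsum_tmap; try by lin.
  by apply: eq_tsum => a x0; tsimp; rewrite fE.
apply: eq_tsum => h1 h2; rewrite (lin_tsum_comm _ _ tf_lin) -fE fco tsum_tmap; try by lin.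
by apply: eq_tsum => a x0; tsimp.
Qed.

End YDTransport.

Section HopfModuleTransport.
Variables (k : fieldType) (H : quasiHopf k) (B : hopfYD H) (X Y : hmodData B).
Variables (f : X -> Y) (g : Y -> X).
Hypotheses (f_mor : is_yd_mor X Y f) (g_lin : linear g) (fK : cancel f g).
Hypothesis f_act : forall t, f (hm_act t) = hm_act (tmap f id t).
Hypothesis f_coact : forall x, ρ (f x) = tmap f id (ρ x).

Local Notation comul := (@hd_comul k H B).
Local Notation ψ := (@braid_left k H B).

Let f_lin := yd_mor_linear f_mor.
Let f_inj := can_inj fK.

(** Here too the axioms are compared in [Y] along maps made injective by [g]; naturality carries [f]
    through the associators, and [f] leaves the strands of [B] where the crossing takes place
    untouched. *)
Lemma hmod_transport : is_hmod Y -> is_hmod X.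
Proof.
move=> modY; have yY := hm_is_yd modY.
have yX := yd_transport f_mor g_lin fK yY; have yB := hopf_yd_car B.
have [[hX hY] hB] := (yd_hmodule yX, yd_hmodule yY, yd_hmodule yB).
have hf := yd_mor_hlinear f_mor.
have fB_mor : is_yd_mor (yd_tens X B) (yd_tens Y B) (tmap f id).
  by apply: tmap_yd_mor => //; apply: id_yd_mor.
have gB_lin : linear (tmap g id : (Y ⊗ B)%type -> (X ⊗ B)%type) by lin.
have fBK := tmapK_l f_lin g_lin fK B.
have fB_lin := yd_mor_linear fB_mor.
have act_mor : is_yd_mor (yd_tens X B) X (@hm_act k H B X).
  apply: (yd_mor_lift f_mor g_lin fK).
  rewrite (_ : (fun _ => _) = fun t => hm_act (tmap f id t)); last exact/funext.
  exact: yd_mor_comp (hm_act_mor modY) fB_mor.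
have coact_mor : is_yd_mor X (yd_tens X B) (@hm_coact k H B X).
  apply: (yd_mor_lift fB_mor gB_lin fBK).
  rewrite (_ : (fun _ => _) = fun x => ρ (f x)); last exact/esym/funext.
  exact: yd_mor_comp (hm_coact_mor modY) f_mor.
have rX := yd_mor_linear act_mor; have ρX := yd_mor_linear coact_mor.
have rY := yd_mor_linear (hm_act_mor modY).
have ρY := yd_mor_linear (hm_coact_mor modY).
have μ_lin := hlinear_lin (hd_mul_hlinear B).
have ψ_h := braid_left_hlinear yB; have ψ_lin := hlinear_lin ψ_h.
have comul_lin := hlinear_lin (hd_comul_hlinear B).
have f_act2 x b : f (x ↼ b) = f x ↼ b by rewrite f_act; tsimp.
split=> //.
- by move=> x; apply: f_inj; rewrite f_act2 (hm_act1 modY).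
- move=> x b c; apply: f_inj; rewrite !f_act2 (hm_actA modY).
  do 2![rewrite lin_tsum_comm //; apply: eq_tsum => ? ?].
  by rewrite f_act2 (yd_mor_act f_mor).
- move=> x; apply: (can_inj (tmapK_l f_lin g_lin fK (yd_tens B B))).
  rewrite -[X in tmap f X](@tmap_id k B B) -yd_assoc_nat; try by lin.
  transitivity (@yd_assoc k H Y B B (tmap (@hm_coact k H B Y) id (ρ (f x)))).
    congr yd_assoc; rewrite f_coact !tmap_idr; try by lin.
    by apply: eq_tmap => // x'; rewrite f_coact.
  by rewrite (hm_coassoc modY) f_coact tmap_id tmap_merger ?tmap_mergel.
- move=> x; apply: f_inj; rewrite -[RHS](hm_counit modY) f_coact.
  have counit_lin := yd_mor_linear (hopf_counit_mor (hopf_ax B)).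
  rewrite tsum_tmap; try by lin.
  by rewrite lin_tsum_comm //; apply: eq_tsum => x0 b; rewrite (linearZ_of f_lin).
move=> x b; apply: (can_inj fBK).
rewrite -f_coact f_act2 (hm_compat modY) !braided_actE // f_coact.
have -> : tmap f id (ρ x) ⊗ comul b = tmap (tmap f id) id (ρ x ⊗ comul b) by tsimp.
rewrite (@yd_assoc_nat _ _ X B (yd_tens B B) Y B (yd_tens B B) f id id); try by lin.
rewrite tmap_id tmap_merger; try by lin.
move: (yd_assoc _) => z.
have -> : tmap f ψ z = tmap f (tmap id id) (tmap id ψ z).
  by rewrite tmap_id tmap_mergel.
rewrite (@yd_assocV_nat _ _ X B (yd_tens B B) Y B (yd_tens B B)
  f id id); try by lin.
rewrite !tmap_comp; try by lin.
by apply: eq_tmap => // w; rewrite f_act.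
Qed.

End HopfModuleTransport.

(** * The structure theorem *)

Section CounitContraction.
Variables (k : fieldType) (H : quasiHopf k) (B : hopfYD H) (N : ydData H).
Hypothesis hN : hmodule N.

Local Notation comul := (@hd_comul k H B).
Local Notation counit := (@hd_counit k H B).

Let hB := yd_hmodule (hopf_yd_car B).
Let counit_lin : linear (counit : B -> k^o) :=
  yd_mor_linear (hopf_counit_mor (hopf_ax B)).

Definition contract_counit (t : (N ⊗ B)%type) : N :=
  \tsum_(n, b <- t) (counit b *: n).

Lemma contract_counit_lin : linear contract_counit.
Proof. by rewrite /contract_counit; lin. Qed.
Let c_lin := contract_counit_lin.

(** The counit of [B] is [H]-linear, so it turns the middle leg of Φ into ε and contraction does not
    see the reassociation. *)
Lemma tmap_contract_counit q : tmap contract_counit id q =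
  \tsum_(n, b1, b2 <- @yd_assoc k H N B B q) (counit b1 *: n) ⊗ b2.
Proof.
pure q => s c; pure s => n b; rewrite {1}/contract_counit; tsimp.
rewrite yd_assoc_tensor //.
pose g (a : H) (x : k^o) (d : H) : (N ⊗ B)%type :=
  (counit b *: (a ▷ n)) ⊗ ((x : k) *: (d ▷ c)).
transitivity (\tsum_(X1, X2, X3 <- Phi H) g X1 (eps H X2) X3).
  rewrite Phi_counit_sum /g; try by lin.
  by rewrite scale1r !hmodule1.
rewrite /g; pure (Phi H) => X1 T; pure T => X2 X3; tsimp.
have /= -> := yd_mor_act (hopf_counit_mor (hopf_ax B)) X2 b.
by rewrite tensorZr -scalerA !tensorZl.
Qed.

Lemma contract_counit_comul (n : N) b :
  tmap contract_counit id (@yd_assocV k H N B B (n ⊗ comul b)) = n ⊗ b.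
Proof.
rewrite tmap_contract_counit yd_assocVK //; tsimp.
rewrite -[in RHS](hopf_counitl (hopf_ax B) b).
rewrite (lin_tsum_comm (g := fun b => n ⊗ b)); last by lin.
by apply: eq_tsum => b1 b2; rewrite tensorZl tensorZr.
Qed.

End CounitContraction.

(** * The Yetter-Drinfeld module of coinvariants and the maps F and G *)

Section Coinvariants.
Variables (k : fieldType) (H : quasiHopf k) (B : hopfYD H) (M : hopfModule B).

Local Notation comul := (@hd_comul k H B).
Local Notation counit := (@hd_counit k H B).
Local Notation r := (@hm_act k H B M).
Local Notation P := (@hm_proj k H B M).
Local Notation val := (@coinv_val k H B M).

Let modM := hm_ax M.
Let yB : is_yd B := hopf_yd_car B.
Let yM : is_yd M := hm_is_yd modM.
Let hB := yd_hmodule yB.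
Let hM := yd_hmodule yM.
Let r_lin := yd_mor_linear (hm_act_mor modM).
Let ρ_lin := yd_mor_linear (hm_coact_mor modM).
Let comul_lin := hlinear_lin (hd_comul_hlinear B).
Let μ_lin := hlinear_lin (hd_mul_hlinear B).
Let counit_lin : linear (counit : B -> k^o) := yd_mor_linear (hopf_counit_mor (hopf_ax B)).
Let P_mor := hm_proj_yd_mor modM.
Let P_lin := yd_mor_linear P_mor.

(** The default [0] is never returned, since [P m] is always coinvariant. *)
Definition coinv_proj (m : M) : coinvT M := insubd (0 : coinvT M) (P m).

Lemma coinv_valP n : val n \in coinv M. Proof. exact: (valP n). Qed.

Lemma coinv_projE m : val (coinv_proj m) = P m.
Proof. by rewrite [LHS]val_insubd hm_proj_coinv. Qed.

Lemma coinv_val_inj : injective val. Proof. exact: val_inj. Qed.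

Lemma coinv_valK : cancel val coinv_proj.
Proof.
move=> n; apply: coinv_val_inj.
by rewrite coinv_projE (hm_proj_id modM) // coinv_valP.
Qed.

Lemma coinv_val_lin : linear val. Proof. by []. Qed.

Lemma coinv_proj_lin : linear coinv_proj.
Proof.
by move=> a m n; apply: coinv_val_inj; rewrite coinv_val_lin !coinv_projE P_lin.
Qed.

(** Projecting puts the values in the subtype by construction; that they are still those of [M] is
    [coinv_val_yd_mor]. *)
Definition coinv_yd : ydData H :=
  @YDData k H (coinvT M) (fun h n => coinv_proj (h ▷ val n))
    (fun n => tmap id coinv_proj (λ (val n))).

Let proj_lin : linear (coinv_proj : M -> coinv_yd) := coinv_proj_lin.
Let val_lin : linear (val : coinv_yd -> M) := coinv_val_lin.

(** As P n = n and P is a morphism, P(h ▷ n) = h ▷ n and (id ⊗ P)λ(n) = λ(n). *)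
Lemma coinv_val_yd_mor : is_yd_mor coinv_yd M val.
Proof.
split=> // [h n|n] /=.
  by rewrite coinv_projE (yd_mor_act P_mor) (hm_proj_id modM) // coinv_valP.
rewrite tmap_idl; try by lin.
have -> : (fun m => val (coinv_proj m)) = P by exact/funext/coinv_projE.
by rewrite -(yd_mor_coact P_mor) (hm_proj_id modM) // coinv_valP.
Qed.

Let val_mor := coinv_val_yd_mor.

Lemma coinv_is_yd : is_yd coinv_yd.
Proof. exact: yd_transport val_mor proj_lin coinv_valK yM. Qed.

Let yN := coinv_is_yd.
Let hN := yd_hmodule yN.
Let N := coinv_yd.
Let val_h := yd_mor_hlinear val_mor.

Definition coinv_mul (t : (N ⊗ B)%type) : M := r (tmap val id t).
Definition coinv_split (m : M) : (N ⊗ B)%type := tmap coinv_proj id (ρ m).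

Local Notation F := coinv_mul.
Local Notation G := coinv_split.

Lemma coinv_mul_yd_mor : is_yd_mor (yd_tens N B) M F.
Proof.
apply: yd_mor_comp (hm_act_mor modM) _.
by apply: tmap_yd_mor => //; apply: id_yd_mor.
Qed.

Let F_mor := coinv_mul_yd_mor.
Let F_lin := yd_mor_linear F_mor.

Lemma coinv_split_lin : linear G.
Proof. by rewrite /coinv_split; lin. Qed.
Let G_lin := coinv_split_lin.

Lemma coinv_splitK : cancel G F.
Proof.
move=> m; rewrite /coinv_mul /coinv_split tmap_idr; try by lin.
have -> : (fun m => val (coinv_proj m)) = P by exact/funext/coinv_projE.
exact: hm_act_projK.
Qed.

Lemma coinv_mulK : cancel F G.
Proof.
have FG_lin : linear (fun t => G (F t)) by lin.
move=> t; pure t => n b.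
have -> : F (n ⊗ b) = val n ↼ b by rewrite /coinv_mul; tsimp.
rewrite /coinv_split hm_coact_coinv_act ?coinv_valP // /galois.
rewrite tmap_idr; try by lin.
tsimp.
have -> : val n ⊗ comul b = tmap val (tmap id id) (n ⊗ comul b).
  by tsimp; rewrite tmap_id.
rewrite (@yd_assocV_nat _ _ N B B M B B val id id); try by lin.
set q := yd_assocV _; rewrite tmap_idr; try by lin.
(* This is P(n ↼ b) = ε(b)n read on [N ⊗ B]; what remains is the counit axiom of [B]. *)
have -> : (fun u => coinv_proj (r (tmap val id u))) = @contract_counit k H B N.
  apply: funext => u.
  have c_lin : linear (@contract_counit k H B N) by apply: contract_counit_lin.
  pure u => n' b'; rewrite /contract_counit; tsimp.
  apply: coinv_val_inj.
  by rewrite coinv_projE (hm_proj_coinv_act modM) ?coinv_valP.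
exact: contract_counit_comul.
Qed.

Lemma coinv_mul_act t : F (@hm_act k H B (hm_tens B N) t) = r (tmap F id t).
Proof.
rewrite /=; pure t => s c; pure s => n b; tsimp.
have -> : F (n ⊗ b) = val n ↼ b by rewrite /coinv_mul; tsimp.
rewrite (hm_actA modM) (lin_tsum_comm _ _ F_lin); apply: eq_tsum => X1 T.
rewrite (lin_tsum_comm _ _ F_lin); apply: eq_tsum => X2 X3.
by rewrite /coinv_mul; tsimp; rewrite (hlinearE val_h).
Qed.

Lemma coinv_mul_coact t : ρ (F t) = tmap F id (@hm_coact k H B (hm_tens B N) t).
Proof.
rewrite /=; pure t => n b; tsimp.
have -> : F (n ⊗ b) = val n ↼ b by rewrite /coinv_mul; tsimp.
rewrite hm_coact_coinv_act ?coinv_valP // galois_tensorE //.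
pure (comul b) => b1 b2; pure (PhiV H) => x1 T; pure T => x2 x3; tsimp.
by rewrite /coinv_mul; tsimp; rewrite (hlinearE val_h).
Qed.

Lemma free_coinv_hmod : is_hmod (hm_tens B N).
Proof.
exact: (hmod_transport (X := hm_tens B N) (f := F) (g := G) F_mor G_lin coinv_mulK
  coinv_mul_act coinv_mul_coact).
Qed.

Lemma coinv_mul_hmod_mor : is_hmod_mor (hm_tens B N) M F.
Proof.
split=> // [t c|t]; last exact: coinv_mul_coact.
by rewrite coinv_mul_act; tsimp.
Qed.

(** The inverse of a structure-preserving bijection preserves the structure: each equation is
    checked after F. *)
Lemma coinv_split_hmod_mor : is_hmod_mor M (hm_tens B N) G.
Proof.
split=> [|m b|m].
- apply: (yd_mor_lift F_mor G_lin coinv_mulK).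
  rewrite (_ : (fun _ => _) = id); last exact/funext/coinv_splitK.
  exact: id_yd_mor.
- apply: (can_inj coinv_mulK).
  by rewrite coinv_splitK coinv_mul_act; tsimp; rewrite coinv_splitK.
apply: (can_inj (tmapK_l F_lin G_lin coinv_mulK B)).
rewrite -coinv_mul_coact coinv_splitK tmap_idr; try by lin.
by rewrite tmap_eq_id // => m'; rewrite coinv_splitK.
Qed.

End Coinvariants.

Theorem theorem5p3 (k : fieldType) (H : quasiHopf k) (B : hopfYD H)
    (M : hopfModule B) :
  exists (act : H -> coinvT M -> coinvT M)
         (coact : coinvT M -> (H ⊗ coinvT M)%type),
    let N := @YDData k H (coinvT M) act coact in
    let F := fun t : (coinvT M ⊗ B)%type => \tsum_(n, b <- t) (coinv_val n ↼ b) in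
    let G := fun m : M => \tsum_(m0, m1 <- ρ m)
      (insubd (0 : coinvT M) (hm_proj m0) ⊗ m1) in
    [/\ is_yd N /\ is_yd_mor N M (@coinv_val k H B M),
        forall m : M, hm_proj m \in coinv M,
        forall (n : M) (b : B), n \in coinv M ->
          ρ (n ↼ b)
            = \tsum_(x1, x2, x3 <- PhiV H) \tsum_(b1, b2 <- hd_comul b)
                ((x1 ▷ n) ↼ (x2 ▷ b1)) ⊗ (x3 ▷ b2)
          /\ hm_proj (n ↼ b) = hd_counit b *: n
      & [/\ is_hmod (hm_tens B N),
            is_hmod_mor (hm_tens B N) M F,
            is_hmod_mor M (hm_tens B N) G,
            cancel F G
          & cancel G F]].
Proof.
exists (@yd_act k H (coinv_yd M)), (@yd_coact k H (coinv_yd M)) => N F G.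
(* F is stated as a sum of actions, [coinv_mul] as the action on a sum; they agree by linearity. *)
have FE : F = @coinv_mul k H B M.
  by apply: funext => t; rewrite /coinv_mul /tmap lin_tsum_comm //;
     apply: yd_mor_linear (hm_act_mor (hm_ax M)).
have GE : G = @coinv_split k H B M by [].
rewrite FE GE; split.
- split; [exact: coinv_is_yd | exact: coinv_val_yd_mor].
- exact: hm_proj_coinv (hm_ax M).
- move=> n b n_coinv; rewrite (hm_coact_coinv_act (hm_ax M)) //.
  by rewrite (galois_tensorE (hm_ax M)) (hm_proj_coinv_act (hm_ax M)).
split.
- exact: free_coinv_hmod.
- exact: coinv_mul_hmod_mor.
- exact: coinv_split_hmod_mor.
- exact: coinv_mulK.
exact: coinv_splitK.
Qed.
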